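(* Let $d\ge3$. There is an algorithm which, given any $M\in\mathsf M_d$ endowed with its minimal $\frac{d}{d-2}$-orientation, computes the blossoming forest $B(M)$ in time linear in the size of $M$.
   Context: $\mathsf M_d$ is the set of $d$-angulations of girth $d$ of a $d$-gon: face-rooted plane maps whose root face is bounded by a simple cycle of length $d$, all other faces have degree $d$, every cycle has length at least $d$, and whose root face is distinct from the outer (unbounded) face. A $(d-2)$-fractional orientation orients the map with each edge replaced by $d-2$ parallel copies (no two copies of the same edge forming a counterclockwise cycle); outdegrees count outgoing copies. A $\frac{d}{d-2}$-orientation is such an orientation in which each vertex incident to the root face has outdegree $d-2$ and every other vertex has outdegree $d$; the minimal one is the unique one without counterclockwise cycle (simple oriented cycle, each edge at least partially oriented along it, with the outer face on its right); it is accessible (every vertex has an oriented path to a root vertex). There is then a unique partition of the edges into $(T_M,C_M)$ where $T_M$ is a spanning cyclic forest (a subgraph with two faces, the root face and an outer face) on which the orientation is accessible, and each edge of $C_M$ is saturated (all copies in one direction) and oriented clockwise (outer face on its left) around the unique cycle it forms with $T_M$. The blossoming forest $B(M)$ is obtained from $M$ by keeping the edges of $T_M$ and cutting each edge of $C_M$ into an opening stem at its origin and a closing stem at its end. *)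

(* Defs.v *)
From HB Require Import structures.
From mathcomp Require Import all_boot all_order all_fingroup.

Set Implicit Arguments.
Unset Strict Implicit.
Unset Printing Implicit Defensive.

(** * Face-rooted plane maps

    A plane map with [n] darts (half-edges) labelled by ['I_n], each dart being
    directed away from the vertex at which it sits.  [rot x] is the next dart
    in clockwise order around the origin of [x], and [opp x] is the other dart
    of the same edge.  The two marked faces, the root face and the outer
    (unbounded) face, are each designated by an arbitrary dart having that face
    on its left. *)

Record plane_map (n : nat) := PlaneMap {
  rot : {perm 'I_n};
  opp : {perm 'I_n};
  root_dart : 'I_n;
  outer_dart : 'I_n;
  oppK : involutive opp;
  opp_neq : forall x, opp x != x;
  map_connected :
    forall x y, connect (fun u v => (v == rot u) || (v == opp u)) x y;
  (* [opp * rot] maps [x] to [rot (opp x)]: the equation is V + F = E + 2 *)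
  map_planar :
    #|porbits rot| + #|porbits (opp * rot)%g| = #|porbits opp| + 2
}.

Section Maps.

Variables (n : nat) (M : plane_map n).

Definition nedges : nat := #|porbits (opp M)|.

(** [rot] being clockwise, [face_next x] is the successor of [x] along the
    contour of the face lying on its left. *)
Definition face_next : {perm 'I_n} := (opp M * rot M)%g.

Definition vertex (x : 'I_n) : {set 'I_n} := porbit (rot M) x.
Definition face (x : 'I_n) : {set 'I_n} := porbit face_next x.

Definition root_face : {set 'I_n} := face (root_dart M).
Definition outer_face : {set 'I_n} := face (outer_dart M).

(** A vertex (given by one of its darts) incident to the root face. *)
Definition root_vertex (x : 'I_n) : bool :=
  [exists y, (y \in vertex x) && (y \in root_face)].

(** Simple cycles of the underlying graph, traversed along the darts of [p]. *)
Definition simple_cycle (p : seq 'I_n) : bool :=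
  [&& p != [::], path.cycle (fun x y => y \in vertex (opp M x)) p,
      uniq [seq vertex x | x <- p] & all (fun x => opp M x \notin p) p].

(** [same_region A x y]: the faces on the left of [x] and of [y] lie in the same
    connected component of the complement of the edges having a dart in [A]. *)
Definition same_region (A : {pred 'I_n}) : rel 'I_n :=
  connect (fun x y => (y == face_next x) ||
    [&& x \notin A, opp M x \notin A & y == opp M x]).

Definition outer_on_left (p : seq 'I_n) : bool :=
  has (fun x => same_region (mem p) x (outer_dart M)) p.

Definition outer_on_right (p : seq 'I_n) : bool :=
  has (fun x => same_region (mem p) (opp M x) (outer_dart M)) p.

(** The class of [d]-angulations of girth [d] of a [d]-gon. *)
Definition d_angulation (d : nat) : Prop :=
  [/\ #|root_face| = d /\
        {in root_face &, injective vertex},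
      forall x, x \notin root_face -> #|face x| = d,
      forall p, simple_cycle p -> d <= size p
    & root_face != outer_face].

(** ** Fractional orientations

    Every edge is replaced by [k] parallel copies.  Seen along the dart [x], the
    copies of its edge are numbered from left to right, and [O x i] says that
    the [i]-th one is directed as [x] is. *)

Section Orientations.

Variables (k : nat) (O : 'I_n -> 'I_k -> bool).

(** Second condition: if, of two copies, the left one went backwards and the
    right one forwards, they would form a counterclockwise cycle. *)
Definition fractional_orientation : Prop :=
  (forall x i, O (opp M x) (rev_ord i) = ~~ O x i) /\
  (forall x (i j : 'I_k), i < j -> ~ (~~ O x i /\ O x j)).

Definition copies_along (x : 'I_n) : nat := #|[set i | O x i]|.

Definition outdegree (x : 'I_n) : nat := \sum_(y in vertex x) copies_along y.

(** The edge of [x] is at least partially oriented along [x]. *)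
Definition oriented_along (x : 'I_n) : bool := [exists i, O x i].

(** All the copies of the edge of [x] are directed along [x]. *)
Definition saturated (x : 'I_n) : bool := [forall i, O x i].

Definition minimal : Prop :=
  forall p, simple_cycle p -> all oriented_along p -> ~~ outer_on_right p.

(** Within the subgraph whose darts are [T], every vertex has an oriented path
    to a vertex incident to the root face. *)
Definition accessible_in (T : {set 'I_n}) : Prop :=
  forall x, exists2 y, root_vertex y &
    connect (fun u v => (v \in vertex u) ||
      [&& u \in T, oriented_along u & v == opp M u]) x y.

(** A spanning subgraph, given by its set of darts, with exactly two faces: the
    root face of the map, and one made of all the other faces of the map. *)
Definition two_faces (T : {set 'I_n}) : Prop :=
  forall x y, same_region (mem T) x y = ((x \in root_face) == (y \in root_face)).

(** The partition [(T_M, C_M)] of the edges; [C_M] is the complement of [T]. *)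
Definition canonical_forest (T : {set 'I_n}) : Prop :=
  [/\ forall x, (opp M x \in T) = (x \in T),
      two_faces T,
      accessible_in T,
      forall x, x \notin T -> saturated x || saturated (opp M x)
    & forall x, x \notin T -> saturated x ->
      forall p, simple_cycle p -> x \in p ->
        {in p, forall y, y != x -> y \in T} -> outer_on_left p].

End Orientations.

(** The [d/(d-2)]-orientations. *)
Definition d_orientation (d : nat) (O : 'I_n -> 'I_(d - 2) -> bool) : Prop :=
  fractional_orientation O /\
  forall x, outdegree O x = if root_vertex x then d - 2 else d.

End Maps.

(** * Blossoming forests *)

Inductive half_edge (n : nat) : Type :=
  | Matched of 'I_n
  | OpeningStem
  | ClosingStem.

Arguments OpeningStem {n}.
Arguments ClosingStem {n}.

(** The cyclic orders [bf_rot] take the stems into account; [bf_root] is a dart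
    on the root face. *)
Record blossoming_forest (n : nat) := BlossomingForest {
  bf_rot : {perm 'I_n};
  bf_half : 'I_n -> half_edge n;
  bf_root : 'I_n
}.

Definition cut_forest (n k : nat) (M : plane_map n) (O : 'I_n -> 'I_k -> bool)
    (T : {set 'I_n}) : blossoming_forest n :=
  {| bf_rot := rot M;
     bf_half := fun x =>
       if x \in T then Matched (opp M x)
       else if saturated O x then OpeningStem else ClosingStem;
     bf_root := root_dart M |}.

(** [B] is the blossoming forest of [M] endowed with [O]. *)
Definition is_blossoming_forest_of (n k : nat) (M : plane_map n)
    (O : 'I_n -> 'I_k -> bool) (B : blossoming_forest n) : Prop :=
  exists2 T, canonical_forest M O T & B = cut_forest M O T.

(** * Machine model

    A unit-cost random access machine with registers and arrays holding natural
    numbers.  Increment and decrement are the only arithmetic operations, so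
    that in linear time only numbers linear in the size of the input arise. *)

Inductive test :=
  | TestEq of nat & nat
  | TestLt of nat & nat.

Inductive program :=
  | Skip
  | Const of nat & nat          (* r := constant *)
  | Copy of nat & nat           (* r := s *)
  | Inc of nat
  | Dec of nat
  | Read of nat & nat & nat     (* r := a[s], [a] an array, [s] a register *)
  | Write of nat & nat & nat    (* a[s] := r *)
  | Seq of program & program
  | If of test & program & program
  | While of test & program.

Record state := State { reg : nat -> nat; arr : nat -> nat -> nat }.

Definition set_reg (s : state) (r v : nat) : state :=
  State [eta reg s with r |-> v] (arr s).

Definition set_arr (s : state) (a i v : nat) : state :=
  State (reg s)
    (fun a' i' => if (a' == a) && (i' == i) then v else arr s a' i').

Definition eval_test (s : state) (b : test) : bool :=
  match b with
  | TestEq r1 r2 => reg s r1 == reg s r2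
  | TestLt r1 r2 => reg s r1 < reg s r2
  end.

(** [exec P s t s']: started in [s], [P] halts in [s'] after [t] steps. *)
Inductive exec : program -> state -> nat -> state -> Prop :=
  | ExecSkip s : exec Skip s 1 s
  | ExecConst s r v : exec (Const r v) s 1 (set_reg s r v)
  | ExecCopy s r r' : exec (Copy r r') s 1 (set_reg s r (reg s r'))
  | ExecInc s r : exec (Inc r) s 1 (set_reg s r (reg s r).+1)
  | ExecDec s r : exec (Dec r) s 1 (set_reg s r (reg s r).-1)
  | ExecRead s r a i : exec (Read r a i) s 1 (set_reg s r (arr s a (reg s i)))
  | ExecWrite s a i r :
      exec (Write a i r) s 1 (set_arr s a (reg s i) (reg s r))
  | ExecSeq P Q s1 s2 s3 t t' :
      exec P s1 t s2 -> exec Q s2 t' s3 -> exec (Seq P Q) s1 (t + t') s3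
  | ExecIfTrue b P Q s s' t :
      eval_test s b -> exec P s t s' -> exec (If b P Q) s t.+1 s'
  | ExecIfFalse b P Q s s' t :
      ~~ eval_test s b -> exec Q s t s' -> exec (If b P Q) s t.+1 s'
  | ExecWhileFalse b P s : ~~ eval_test s b -> exec (While b P) s 1 s
  | ExecWhileTrue b P s1 s2 s3 t t' :
      eval_test s1 b -> exec P s1 t s2 -> exec (While b P) s2 t' s3 ->
      exec (While b P) s1 (t + t').+1 s3.

Definition table (n : nat) (f : 'I_n -> nat) (i : nat) : nat :=
  if insub i is Some x then f x else 0.

(** Input: a map and a fractional orientation.  Without a counterclockwise
    cycle inside an edge, the orientation of the copies is determined by the
    number of those directed along each dart. *)
Definition input (n k : nat) (M : plane_map n) (O : 'I_n -> 'I_k -> bool) :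
    state :=
  State (fun r => match r with
                  | 0 => n
                  | 1 => root_dart M
                  | 2 => outer_dart M
                  | _ => 0
                  end)
        (fun a => match a with
                  | 0 => table (fun x => rot M x)
                  | 1 => table (fun x => opp M x)
                  | 2 => table (copies_along O)
                  | _ => fun=> 0
                  end).

(** Output: array 2 tells the kind of each half-edge, and array 1 gives the
    other half of those that are not stems. *)
Definition output_represents (n : nat) (s : state) (B : blossoming_forest n) :
    Prop :=
  [/\ reg s 0 = n,
      reg s 1 = bf_root B,
      forall x : 'I_n, arr s 0 x = bf_rot B x
    & forall x : 'I_n,
      match bf_half B x with
      | Matched y => arr s 2 x = 0 /\ arr s 1 x = y
      | OpeningStem => arr s 2 x = 1
      | ClosingStem => arr s 2 x = 2
      end].

(* Main.v *)
(** The contour of the canonical forest [T], walked with the outer side on its left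
    from the outer dart, meets each cut edge first at its origin, since the outer
    face lies on the left of the cycle closed by this edge. Hence an edge met for the
    first time at a dart from which it is not saturated belongs to [T]. The converse
    fails only on the path [gamma] of [T] which leads from the outer vertex to the
    root face: the other edges of [T] are first met at their end. So [gamma] has to
    be found beforehand. A cut edge leaving the right side of [gamma] (or [gamma]
    itself, towards its right) leads further along the contour, hence the vertices
    reached from there are cut off from the left side of [gamma]: a depth-first
    search from the outer vertex along the orientation, exploring the right first,
    backtracks from such an edge, and its stack is [gamma] when it first meets the
    root cycle.

    The planarity arguments rest on Euler's relation, which passes from the map to
    all its spanning submaps, so that an edge separates two faces of a submap if and
    only if its deletion does not disconnect its ends. *)

Require Import Defs.
From mathcomp Require Import all_boot all_order all_fingroup.
From mathcomp Require Import zify.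
Import Defs.

Set Implicit Arguments.
Unset Strict Implicit.
Unset Printing Implicit Defensive.

Lemma porbit_iterP (T : finType) (s : {perm T}) x y :
  reflect (exists i, y = iter i s x) (y \in porbit s x).
Proof.
by apply: (iffP (porbitP s x y)) => -[i ->]; exists i; rewrite permX.
Qed.

Lemma porbit_step (T : finType) (s : {perm T}) x : s x \in porbit s x.
Proof. by apply/porbit_iterP; exists 1. Qed.

Lemma porbit_trans (T : finType) (s : {perm T}) x y z :
  y \in porbit s x -> z \in porbit s y -> z \in porbit s x.
Proof. by rewrite -eq_porbit_mem => /eqP->. Qed.

(** * Spanning submaps: contours, components and faces *)

Section Submaps.

Variables (n : nat) (M : plane_map n).
Local Notation dart := 'I_n.
Implicit Types (S : {set dart}) (x y a b : dart).

Definition opp_closed S := [forall x, (opp M x \in S) == (x \in S)].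

Lemma opp_closedP S : reflect (forall x, (opp M x \in S) = (x \in S)) (opp_closed S).
Proof. by apply: (iffP forallP) => h x; apply/eqP. Qed.

Definition edge a : {set dart} := [set a; opp M a].

Lemma in_edge a x : (x \in edge a) = (x == a) || (x == opp M a).
Proof. by rewrite !inE. Qed.

Lemma eq_opp x y : (opp M x == y) = (x == opp M y).
Proof. by apply/eqP/eqP => [<-|->]; rewrite (oppK M). Qed.

Lemma opp_edge a x : (opp M x \in edge a) = (x \in edge a).
Proof. by rewrite !inE !eq_opp (oppK M) orbC. Qed.

Lemma opp_closedU S a : opp_closed S -> opp_closed (edge a :|: S).
Proof.
by move=> /opp_closedP cS; apply/opp_closedP => x; rewrite in_setU opp_edge cS -in_setU.
Qed.

Lemma opp_closedD S a : opp_closed S -> opp_closed (S :\: edge a).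
Proof.
by move=> /opp_closedP cS; apply/opp_closedP => x; rewrite in_setD opp_edge cS -in_setD.
Qed.

Lemma opp_closedT : opp_closed setT.
Proof. by apply/opp_closedP => x; rewrite !inE. Qed.

Lemma edge_sub S a : opp_closed S -> a \in S -> edge a \subset S.
Proof.
move=> /opp_closedP cS aS; apply/subsetP => x.
by rewrite in_edge => /orP[]/eqP->; rewrite ?cS.
Qed.

Lemma edgeK S a : opp_closed S -> a \in S -> edge a :|: (S :\: edge a) = S.
Proof.
move=> cS aS; rewrite setDE setUIr setUCr setIT; apply/setUidPr.
exact: edge_sub.
Qed.

(** A dart outside [S] is fixed, that is, turned into a stem: it keeps its place around its vertex,
    so that all submaps share the darts and [rot] of the map. *)
Definition sub_opp_fun S x := if x \in S then opp M x else x.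

Lemma sub_opp_inj S : opp_closed S -> injective (sub_opp_fun S).
Proof.
move=> /opp_closedP cS x y; rewrite /sub_opp_fun.
case: ifP => xS; case: ifP => yS //.
- exact: perm_inj.
- by move=> E; rewrite -E cS xS in yS.
- by move=> E; rewrite E cS yS in xS.
Qed.

(* The identity (a junk value) unless [S] is stable under [opp]. *)
Definition contour S : {perm dart} :=
  if opp_closed S =P true is ReflectT cS then (perm (sub_opp_inj cS) * rot M)%g
  else 1%g.

Lemma contourE S x : opp_closed S ->
  contour S x = rot M (if x \in S then opp M x else x).
Proof.
by rewrite /contour; case: eqP => // cS _; rewrite permM permE.
Qed.

(** Its classes are the connected components of the spanning submap, isolated vertices included. *)
Definition link S : rel dart :=
  fun x y => (y \in vertex M x) || (x \in S) && (y == opp M x).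

Definition linked S : rel dart := connect (link S).

Lemma linked_sym S : opp_closed S -> connect_sym (link S).
Proof.
move=> /opp_closedP cS; apply: sym_connect_sym => x y.
rewrite /link /vertex porbit_sym; congr (_ || _).
apply/andP/andP => -[xS /eqP E]; rewrite ?E.
  by rewrite cS (oppK M).
by rewrite cS (oppK M).
Qed.

Lemma linked_vertex S x y : y \in vertex M x -> linked S x y.
Proof. by move=> h; apply: connect1; rewrite /link h. Qed.

Lemma linked_opp S x : x \in S -> linked S x (opp M x).
Proof. by move=> h; apply: connect1; rewrite /link h eqxx orbT. Qed.

Lemma linked_rot S x : linked S x (rot M x).
Proof. by apply: linked_vertex; apply: porbit_step. Qed.

Lemma linked_trans S y x z : linked S x y -> linked S y z -> linked S x z.
Proof. exact: connect_trans. Qed.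

Lemma linked_mono S S' x y : S \subset S' -> linked S x y -> linked S' x y.
Proof.
move=> sub; apply: connect_sub => u v /orP[h|/andP[h /eqP->]].
  exact: linked_vertex.
by apply: linked_opp; apply: (subsetP sub).
Qed.

Lemma linked_contour S x y : opp_closed S ->
  y \in porbit (contour S) x -> linked S x y.
Proof.
move=> cS /porbit_iterP[i ->]; elim: i => [|i IH]; first exact: connect0.
apply: (linked_trans IH); rewrite iterS contourE //.
case: ifP => h; last exact: linked_rot.
exact: linked_trans (linked_opp h) (linked_rot _ _).
Qed.

Lemma linkedU S a x y : opp_closed S -> linked S a (opp M a) ->
  linked (edge a :|: S) x y = linked S x y.
Proof.
move=> cS la; apply/idP/idP; last exact: (linked_mono (subsetUr _ _)).
apply: connect_sub => u v /orP[h|/andP[]]; first exact: linked_vertex.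
rewrite inE in_edge -orbA => /or3P[/eqP->|/eqP->|uS] /eqP-> //.
  by rewrite (oppK M) -/(linked S _ _) /linked linked_sym.
exact: linked_opp.
Qed.

(** ** Euler's relation is inherited by submaps *)

Definition nclasses S := n_comp (link S) dart.
Definition nfaces S := #|porbits (contour S)|.

(** Joining two stems into an edge exchanges their successors. Adding an edge is thus a product with
    a transposition, which splits a face or merges two. *)
Lemma contourU S a : opp_closed S -> a \notin S ->
  contour (edge a :|: S) = (tperm a (opp M a) * contour S)%g.
Proof.
move=> cS aS; have cS' := opp_closedU a cS; apply/permP => x.
have oaS : opp M a \notin S by rewrite (opp_closedP _ cS).
rewrite permM !contourE // inE in_edge.
case: tpermP => [->|->|/eqP xa /eqP xoa].
- by rewrite eqxx (negbTE oaS).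
- by rewrite eqxx orbT (negbTE aS) (oppK M).
- by rewrite (negbTE xa) (negbTE xoa).
Qed.

Lemma nfacesU S a : opp_closed S -> a \notin S ->
  nfaces (edge a :|: S) + (a \notin porbit (contour S) (opp M a)).*2
  = nfaces S + 1.
Proof.
move=> cS aS; rewrite /nfaces contourU //.
by have := porbits_mul_tperm (contour S) a (opp M a); rewrite /= eq_sym (opp_neq M).
Qed.

Lemma nclassesU S a : opp_closed S -> nclasses S <= nclasses (edge a :|: S) + 1.
Proof.
move=> cS; have cS' := opp_closedU a cS; set S' := edge a :|: S.
have sS := linked_sym cS; have sS' := linked_sym cS'.
(* The class of [opp M a] is left out: the others stay distinct, since only the classes of the two
   ends can merge. *)
pose A := [set x | roots (link S) x] :\ root (link S) (opp M a).
have linkedE x y : linked S' x y ->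
  [|| linked S x y, linked S x a && linked S (opp M a) y
    | linked S x (opp M a) && linked S a y].
  move=> h; pose P := [pred y | [|| linked S x y, linked S x a && linked S (opp M a) y
    | linked S x (opp M a) && linked S a y]].
  suff clP : closed (link S') P.
    by have := closed_connect clP h; rewrite !inE /linked connect0 /= => <-.
  apply: (intro_closed sS') => u v luv; rewrite !inE.
  have step w : linked S u v -> linked S w u -> linked S w v.
    by move=> h1 h2; apply: linked_trans h2 h1.
  case/orP: luv => [h1|/andP[]].
    have h2 := linked_vertex S h1.
    by case/or3P=> [h3|/andP[-> h3]|/andP[-> h3]]; rewrite (step _ h2 h3) ?orbT.
  rewrite inE in_edge -orbA => ua /eqP ->; case/or3P: ua => [/eqP->|/eqP->|uS].
  - rewrite /linked !connect0 !andbT -!/(linked _ _ _).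
    by case/or3P=> [->|/andP[-> _]|->]; rewrite ?orbT.
  - rewrite (oppK M) /linked !connect0 !andbT -!/(linked _ _ _).
    by case/or3P=> [->|->|/andP[-> _]]; rewrite ?orbT.
  - have step2 w : linked S w u -> linked S w (opp M u).
      by move=> h1; apply: linked_trans h1 (linked_opp uS).
    by case/or3P=> [h3|/andP[-> h3]|/andP[-> h3]]; rewrite (step2 _ h3) ?orbT.
have injA : {in A &, injective (root (link S'))}.
  move=> x y; rewrite !inE => /andP[xb /eqP rx] /andP[yb /eqP ry] /eqP.
  rewrite root_connect // => /linkedE /or3P[h|/andP[_ h]|/andP[h _]].
  - by rewrite -rx -ry; apply/eqP; rewrite root_connect.
  - by case/eqP: yb; rewrite -ry; apply/eqP; rewrite root_connect // sS.
  - by case/eqP: xb; rewrite -rx; apply/eqP; rewrite root_connect.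
have -> : nclasses S = #|A| + 1.
  rewrite /nclasses /n_comp_mem addnC.
  rewrite [LHS](cardD1 (root (link S) (opp M a))) !inE roots_root //=.
  by congr (_ + _); apply: eq_card => x; rewrite !inE andbT.
rewrite leq_add2r -(card_in_imset injA) /nclasses /n_comp_mem subset_leq_card //.
by apply/subsetP => _ /imsetP[x _ ->]; rewrite !inE roots_root.
Qed.

Lemma nclassesU_linked S a : opp_closed S -> linked S a (opp M a) ->
  nclasses (edge a :|: S) = nclasses S.
Proof.
move=> cS la; apply: eq_n_comp => x y; exact: linkedU.
Qed.

Lemma card_edge_U S a : opp_closed S -> a \notin S -> #|edge a :|: S| = #|S| + 2.
Proof.
move=> cS aS; rewrite cardsU cards2 eq_sym (opp_neq M) /= addnC.
rewrite (_ : edge a :&: S = set0) ?cards0 ?subn0 //.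
apply/setP => x; rewrite !inE; apply/negP => /andP[/orP[]/eqP->].
  by rewrite (negbTE aS).
by rewrite (opp_closedP _ cS) (negbTE aS).
Qed.

(** The quantity [4 * nclasses S + #|S| - 2 * nfaces S] cannot decrease. If the ends share a face,
    it gains 2 from the edge and loses 2 by the split; otherwise it gains 2 from the edge and 2 from
    the merged faces, and loses at most 4 with a component. *)
Lemma euler_step S a : opp_closed S -> a \notin S ->
  4 * nclasses S + #|S| + 2 * nfaces (edge a :|: S)
  <= 4 * nclasses (edge a :|: S) + #|edge a :|: S| + 2 * nfaces S.
Proof.
move=> cS aS; rewrite card_edge_U //.
have := nfacesU cS aS; case: (boolP (a \in _)) => h /= E.
  have la : linked S a (opp M a) by apply: linked_contour; rewrite // porbit_sym.
  rewrite nclassesU_linked //; lia.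
have := nclassesU a cS; lia.
Qed.

Lemma euler_mono S S' : opp_closed S -> opp_closed S' -> S \subset S' ->
  4 * nclasses S + #|S| + 2 * nfaces S'
  <= 4 * nclasses S' + #|S'| + 2 * nfaces S.
Proof.
move=> cS cS'; have [m] := ubnP (#|S'| - #|S|).
elim: m S cS => // m IH S cS lt_m sub.
have [/eqP ->|] := boolP (S == S'); first by [].
rewrite eqEsubset sub andTb => /subsetPn[a aS' aS].
have sub1 : edge a :|: S \subset S' by rewrite subUset sub edge_sub.
have hc : #|edge a :|: S| <= #|S'| := subset_leq_card sub1.
have lt2 : #|S'| - #|edge a :|: S| < m by move: hc; rewrite card_edge_U //; lia.
have := IH _ (opp_closedU a cS) lt2 sub1; rewrite card_edge_U //.
have := euler_step cS aS; rewrite card_edge_U //. lia.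
Qed.

Lemma contour_setT : contour setT = face_next M.
Proof.
by apply/permP => x; rewrite contourE ?opp_closedT // inE /face_next permM.
Qed.

Lemma opp_closed0 : opp_closed set0.
Proof. by apply/opp_closedP => x; rewrite !inE. Qed.

Lemma contour_set0 : contour set0 = rot M.
Proof. by apply/permP => x; rewrite contourE ?opp_closed0 // inE. Qed.

Lemma ndarts : n = 2 * nedges M.
Proof.
have cardE x : #|porbit (opp M) x| = 2.
  rewrite (_ : porbit (opp M) x = [set x; opp M x]).
    by rewrite cards2 eq_sym (opp_neq M).
  apply/setP => y; rewrite !inE; apply/porbit_iterP/orP.
    case=> i ->; elim: i => [|i]; first by left.
    by rewrite iterS => -[]/eqP->; [right|left; rewrite (oppK M)].
  by case=> /eqP->; [exists 0|exists 1].
have/card_uniform_partition : {in porbits (opp M), forall A : {set dart}, #|A| = 2}.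
  by move=> _ /imsetP[x _ ->].
move/(_ setT); rewrite cardsT card_ord /nedges mulnC; apply.
apply/and3P; split.
- rewrite eqEsubset subsetT; apply/subsetP => x _; apply/bigcupP.
  by exists (porbit (opp M) x); [exact: imset_f|exact: porbit_id].
- apply/trivIsetP => _ _ /imsetP[x _ ->] /imsetP[y _ ->] /eqP neq.
  apply/pred0Pn => -[z /andP[/= zx zy]]; case: neq.
  move: zx zy; rewrite -!eq_porbit_mem => /eqP-> /eqP->; by [].
- by apply/imsetP => -[x _ E]; have := porbit_id (opp M) x; rewrite -E inE.
Qed.

Lemma linked_setT x y : linked setT x y.
Proof.
apply: connect_sub (map_connected M x y) => u v /orP[/eqP->|/eqP->].
  exact: linked_rot.
by apply: linked_opp; rewrite inE.
Qed.

Lemma nclasses_setT : n > 0 -> nclasses setT = 1.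
Proof.
move=> n0; rewrite -(n_comp_connect (linked_sym opp_closedT) (Ordinal n0)).
by apply: eq_n_comp_r => x; rewrite [RHS]linked_setT.
Qed.

Lemma nclasses_set0 : #|porbits (rot M)| <= nclasses set0.
Proof.
have -> : porbits (rot M) = porbit (rot M) @: [set x | roots (link set0) x].
  apply/setP => A; apply/imsetP/imsetP => -[x _ ->]; last by exists x.
  exists (fingraph.root (link set0) x).
    by rewrite inE; apply: roots_root; apply: linked_sym opp_closed0.
  apply/eqP; rewrite eq_porbit_mem porbit_sym -contour_set0.
  have : linked set0 x (fingraph.root (link set0) x) by apply: connect_root.
  rewrite contour_set0 => /connectP[p + ->]; elim: p x => [|z p IH] x /=.
    by rewrite porbit_id.
  rewrite {1}/link !inE andFb orbF => /andP[xz /IH]; apply: porbit_trans xz.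
apply: leq_trans (leq_imset_card _ _) _.
by rewrite /nclasses /n_comp_mem subset_leq_card //; apply/subsetP => x; rewrite !inE andbT.
Qed.

(** This is V - E + F = 2C, faces being counted component by component. The monotone quantity of
    [euler_step] is at least 2V without edges, where the faces are the vertices, and equals 2V on
    the whole map by planarity. *)
Lemma euler S : opp_closed S ->
  4 * nclasses S + #|S| = 2 * #|porbits (rot M)| + 2 * nfaces S.
Proof.
move=> cS; have [n0|n0] := posnP n.
  have n0' (x : dart) : False by case: x => x; rewrite [X in _ < X]n0.
  have card0 (T : finType) (A : {set T}) : (T -> dart) -> #|A| = 0.
    by move=> f; apply: eq_card0 => x; case: (n0' (f x)).
  have porb0 (s : {perm dart}) : #|porbits s| = 0.
    by apply: eq_card0 => A; apply/imsetP => -[x]; case: (n0' x).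
  have class0 : nclasses S = 0 by apply: eq_card0 => x; case: (n0' x).
  by rewrite /nfaces !porb0 (card0 _ _ id) class0.
have := euler_mono cS opp_closedT (subsetT S).
have := euler_mono opp_closed0 cS (sub0set S).
have -> : nfaces set0 = #|porbits (rot M)| by rewrite /nfaces contour_set0.
have -> : nfaces setT = #|porbits (face_next M)| by rewrite /nfaces contour_setT.
rewrite nclasses_setT // cards0 cardsT card_ord.
have := nclasses_set0; have := map_planar M; have := ndarts; rewrite /nedges /face_next.
lia.
Qed.

(** The number of components does not change, so the new edge adds a face, which it can only do by
    splitting one that contains both its ends. *)
Lemma linked_same_face S a : opp_closed S -> a \notin S ->
  linked S a (opp M a) -> opp M a \in porbit (contour S) a.
Proof.
move=> cS aS la; have := euler cS; have := euler (opp_closedU a cS).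
rewrite card_edge_U // nclassesU_linked //; have := nfacesU cS aS.
rewrite (porbit_sym _ (opp M a)); case: (boolP (a \in _)) => [_ _|_ /=]; last lia.
by [].
Qed.

(** Multiplying by the transposition, [a] and [opp M a] share a face before the deletion exactly
    when they do not after it; after it, sharing a face means being linked. *)
Lemma same_face_unlinked S a : opp_closed S -> a \in S ->
  (opp M a \in porbit (contour S) a) = ~~ linked (S :\: edge a) a (opp M a).
Proof.
move=> cS aS; have cD := opp_closedD a cS; have aD : a \notin S :\: edge a.
  by rewrite !inE eqxx.
have := nfacesU cD aD; rewrite edgeK // => E.
have c2 : contour (S :\: edge a) = (tperm a (opp M a) * contour S)%g.
  by have := contourU cD aD; rewrite edgeK // => ->; rewrite mulgA tperm2 mul1g.
have := porbits_mul_tperm (contour S) a (opp M a).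
rewrite /= -c2 -!/(nfaces _) [a == _]eq_sym (opp_neq M) /=.
rewrite (porbit_sym _ a) => E2.
have same : (opp M a \in porbit (contour (S :\: edge a)) a)
  = linked (S :\: edge a) a (opp M a).
  by apply/idP/idP => [/linked_contour|/linked_same_face]; apply.
rewrite -same; move: E E2; rewrite [a \in porbit _ _]porbit_sym.
by case: (_ \in _); case: (_ \in _) => //=; lia.
Qed.

(** ** Cycles *)

Definition followed : rel dart := fun x y => y \in vertex M (opp M x).

Lemma simple_cycle_uniq p : simple_cycle M p -> uniq p.
Proof. by case/and4P=> _ _ /map_uniq. Qed.

Lemma simple_cycle_oppN p x : simple_cycle M p -> x \in p -> opp M x \notin p.
Proof. by case/and4P=> _ _ _ /allP; apply. Qed.

Lemma uniq_map_inj (T T' : eqType) (f : T -> T') (s : seq T) :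
  uniq (map f s) -> {in s &, injective f}.
Proof.
elim: s => //= z s IH /andP[zs /IH inj] u v.
rewrite !inE => /predU1P[->|us] /predU1P[->|vs] E //; last exact: inj.
  by rewrite E map_f in zs.
by rewrite -E map_f in zs.
Qed.

Lemma simple_cycle_vertex p x y : simple_cycle M p -> x \in p -> y \in p ->
  y \in vertex M x -> x = y.
Proof.
case/and4P=> _ _ Up _ xp yp yx; apply: (uniq_map_inj Up) => //.
by apply/eqP; rewrite eq_porbit_mem porbit_sym.
Qed.

Lemma simple_cycle_next p x : simple_cycle M p -> x \in p -> followed x (next p x).
Proof. by case/and4P=> _ cp _ _; apply: next_cycle. Qed.

Lemma linked_path S x u q : path followed u (rcons q x) -> {subset q <= S} ->
  linked S (opp M u) x.
Proof.
elim: q u => [|v q IH] u /=; first by rewrite andbT => h _; apply: linked_vertex.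
move=> /andP[h1 h2] sub; apply: linked_trans (linked_vertex S h1) _.
have vS : v \in S by apply: sub; rewrite mem_head.
apply: linked_trans (linked_opp vS) (IH _ h2 _) => w wq.
by apply: sub; rewrite inE wq orbT.
Qed.

(** A step of a region follows a face of the map or crosses an edge outside [A]. At a dart outside
    [S], the former is a crossing followed by a step of the contour. *)
Lemma region_contour (A : {pred dart}) S u v : opp_closed S -> {subset A <= S} ->
    (forall x, x \notin A -> opp M x \notin A -> opp M x \in porbit (contour S) x) ->
  same_region M A u v -> v \in porbit (contour S) u.
Proof.
move=> cS subA cross /connectP[q + ->].
elim: q u => [|w q IH] u /=; first by rewrite porbit_id.
case/andP=> uw /IH; apply: porbit_trans => {IH}.
case/orP: uw => [/eqP->|/and3P[up oup /eqP->]]; last exact: cross.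
rewrite /face_next permM; have [uS|uS] := boolP (u \in S).
  by have := porbit_step (contour S) u; rewrite contourE // uS.
have ouS : opp M u \notin S by rewrite (opp_closedP _ cS).
apply: porbit_trans (cross u _ _) _; try by apply: contra (subA _) _.
by have := porbit_step (contour S) (opp M u); rewrite contourE // (negbTE ouS).
Qed.

(** Jordan's theorem, for a simple cycle of the map: the edges of a minimal
    connected spanning submap containing the cycle, but not lying on it, have the
    same face on both sides, whereas those of the cycle do not. *)
Lemma jordan p x : simple_cycle M p -> x \in p ->
  ~~ same_region M (mem p) x (opp M x).
Proof.
move=> sp xp.
pose Sp : {set dart} := [set y | (y \in p) || (opp M y \in p)].
pose conn S := [forall x, forall y, linked S x y].
pose P S := [&& opp_closed S, Sp \subset S & conn S].
have [S /minsetP[/and3P[cS subS /forallP connS] minS]] : {S | minset P S}.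
  apply: ex_minset; exists setT; apply/and3P; split; rewrite ?opp_closedT ?subsetT //.
  by apply/forallP => y; apply/forallP => z; apply: linked_setT.
have {}connS y z : linked S y z by have /forallP := connS y; apply.
have cross y : y \notin p -> opp M y \notin p -> opp M y \in porbit (contour S) y.
  move=> yp oyp; have [yS|yS] := boolP (y \in S); last exact: linked_same_face.
  rewrite same_face_unlinked //; apply/negP => ly.
  have cD := opp_closedD y cS.
  have : S :\: edge y = S.
    apply: minS; last exact: subsetDl.
    apply/and3P; split=> //.
      apply/subsetP => z zSp; rewrite inE (subsetP subS _ zSp) andbT in_edge.
      apply/norP; split; apply: contraTneq zSp => ->.
        by rewrite inE (negbTE yp) (negbTE oyp).
      by rewrite inE (oppK M) (negbTE yp) (negbTE oyp).
    by apply/forallP => u; apply/forallP => v; rewrite -(linkedU _ _ cD ly) edgeK.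
  by move/setP/(_ y); rewrite !inE eqxx yS.
have subp : {subset mem p <= S}.
  by move=> y yp; apply: (subsetP subS); rewrite inE yp.
have regionP := region_contour cS subp cross.
apply/negP => /regionP; have xS : x \in S by apply: (subsetP subS); rewrite inE xp.
rewrite same_face_unlinked // => /negP[].
have [i q Ep] := rot_to xp; have Uq : uniq (x :: q).
  by rewrite -Ep rot_uniq; apply: simple_cycle_uniq.
have memp y : (y \in x :: q) = (y \in p) by rewrite -Ep mem_rot.
have cD := opp_closedD x cS; rewrite /linked linked_sym //.
apply: (@linked_path _ x x q).
  by case/and4P: sp => _ + _ _; rewrite -(rot_cycle i) Ep.
move=> y yq; rewrite inE in_edge; apply/andP; split.
  apply/norP; split; first by apply: contraTneq yq => ->; case/andP: Uq.
  have : y \in p by rewrite -memp inE yq orbT.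
  by apply: contraTneq => ->; apply: simple_cycle_oppN.
by apply: (subsetP subS); rewrite inE -memp inE yq orbT.
Qed.

Lemma same_region_trans (A : {pred dart}) y x z :
  same_region M A x y -> same_region M A y z -> same_region M A x z.
Proof. exact: connect_trans. Qed.

Lemma same_region_next (A : {pred dart}) x : same_region M A x (face_next M x).
Proof. by apply: connect1; rewrite eqxx. Qed.

Lemma same_region_cross (A : {pred dart}) x : x \notin A -> opp M x \notin A ->
  same_region M A x (opp M x).
Proof. by move=> h1 h2; apply: connect1; rewrite h1 h2 eqxx orbT. Qed.

Lemma same_region_rot (A : {pred dart}) x : x \notin A -> opp M x \notin A ->
  same_region M A x (rot M x).
Proof.
move=> h1 h2; apply: same_region_trans (same_region_cross h1 h2) _.
by have := same_region_next A (opp M x); rewrite /face_next permM (oppK M).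
Qed.

(** Turning clockwise from [opp M x] to the next dart of the simple cycle crosses only edges off the
    cycle. *)
Lemma same_region_left p x : simple_cycle M p -> x \in p ->
  same_region M (mem p) x (next p x).
Proof.
move=> sp xp; set y := next p x; have yp : y \in p by rewrite mem_next.
have oxp := simple_cycle_oppN sp xp.
have xy : y \in vertex M (opp M x) := simple_cycle_next sp xp.
have exk : exists k, iter k (rot M) (opp M x) == y.
  by case/porbit_iterP: xy => i ->; exists i.
have [[|k] /eqP Ek mink] := ex_minnP exk.
  by rewrite /= in Ek; rewrite Ek yp in oxp.
apply: same_region_trans (same_region_next _ _) _; rewrite -Ek /face_next permM iterSr.
have : k <= k by []; elim: {-2}k => [|j IH] ltjk; first exact: connect0.
have vj : iter j (rot M) (rot M (opp M x)) \in vertex M (opp M x).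
  by apply/porbit_iterP; exists j.+1; rewrite iterSr.
apply: same_region_trans (IH (ltnW ltjk)) _; rewrite iterS; move: vj; set b := iter j _ _ => vj.
have Eb : iter j.+1 (rot M) (opp M x) = b by rewrite iterSr.
apply: same_region_rot; apply/negP => hb.
  have : b == y.
    apply/eqP; apply: (simple_cycle_vertex sp hb yp).
    apply: porbit_trans xy; by rewrite porbit_sym.
  by rewrite -Eb => /mink; rewrite ltnS leqNgt ltjk.
(* Were [opp M b] on the cycle, its successor would be [y], so it would be [x], and [y] would be
   reached in fewer turns. *)
have nb : next p (opp M b) = y.
  have h := simple_cycle_next sp hb; rewrite /followed (oppK M) in h.
  apply: (simple_cycle_vertex sp _ yp); first by rewrite mem_next.
  apply: porbit_trans xy; rewrite porbit_sym; exact: porbit_trans vj h.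
have Eb2 : b = opp M x.
  have Up := simple_cycle_uniq sp.
  by apply/eqP; rewrite -eq_opp -(prev_next Up (opp M b)) nb /y prev_next.
have : iter (k - j) (rot M) (opp M x) == y.
  by rewrite -{1}Eb2 -Eb -iterD -Ek; apply/eqP; congr iter; lia.
by move/mink; lia.
Qed.

Lemma same_region_cycle p x z : simple_cycle M p -> x \in p -> z \in p ->
  same_region M (mem p) x z.
Proof.
move=> sp xp zp.
have cp : path.cycle (same_region M (mem p)) p.
  apply: cycle_from_next; first exact: simple_cycle_uniq.
  by move=> y yp; apply: same_region_left.
have [i q Ep] := rot_to xp.
have : z \in x :: q by rewrite -Ep mem_rot.
rewrite inE => /predU1P[->|zq]; first exact: connect0.
have : path (same_region M (mem p)) x (rcons q x) by rewrite -(rot_cycle i) Ep in cp.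
move/(order_path_min (fun y x z => @same_region_trans (mem p) y x z)) => /allP; apply.
by rewrite mem_rcons inE zq orbT.
Qed.

Lemma contour_region (A : {pred dart}) S u v : opp_closed S -> {subset A <= S} ->
  v \in porbit (contour S) u -> same_region M A u v.
Proof.
move=> cS subA /porbit_iterP[i ->]; elim: i => [|i IH]; first exact: connect0.
apply: same_region_trans IH _; rewrite iterS; set x := iter i _ _.
rewrite contourE //; case: ifP => xS.
  by have := same_region_next A x; rewrite /face_next permM.
apply: same_region_rot; apply: contraFN xS; first exact: subA.
by rewrite -(opp_closedP _ cS); apply: subA.
Qed.

(** The path of [S] between the ends of [x] is shortened as a sequence of vertices, by means of [e];
    its darts are then chosen anew, and [x] closes it. *)
Lemma simple_cycle_through S x : x \notin S -> opp M x \notin S ->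
  linked S (opp M x) x ->
  exists p, [/\ simple_cycle M p, x \in p & {in p, forall y, y != x -> y \in S}].
Proof.
move=> xS oxS lx.
pose e (U V : {set dart}) :=
  [exists u in S, (vertex M u == U) && (vertex M (opp M u) == V)].
have : connect e (vertex M (opp M x)) (vertex M x).
  case/connectP: lx => q + E; rewrite [in vertex M x]E => {E}; elim: q (opp M x) => //= v q IH u.
  case/andP=> /orP[uv|/andP[uS /eqP->]] /IH.
    by have /eqP-> : vertex M u == vertex M v by rewrite eq_porbit_mem porbit_sym.
  by apply: connect_trans; apply: connect1; apply/existsP; exists u; rewrite uS !eqxx.
case/connectP=> Q0 /shortenP[Q pQ UQ _ ] EQ.
have [q [Sq sq tq]] : exists q, [/\ {subset q <= S},
    map (vertex M) q = belast (vertex M (opp M x)) Q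
    & map (vertex M \o opp M) q = Q].
  elim: Q (vertex M (opp M x)) pQ {UQ EQ Q0} => [|V Q IH] U /=; first by exists [::].
  case/andP=> /existsP[u /and3P[uS /eqP Eu /eqP Ev]] /IH[q [h1 h2 h3]].
  exists (u :: q); rewrite /= Eu Ev h2 h3; split=> // v.
  by rewrite inE => /predU1P[->|/h1].
have src : map (vertex M) (x :: q) = vertex M x :: belast (vertex M (opp M x)) Q.
  by rewrite /= sq.
have tgt : map (vertex M \o opp M) (x :: q) = vertex M (opp M x) :: Q by rewrite /= tq.
have Usrc : uniq (map (vertex M) (x :: q)).
  rewrite src EQ; move: UQ; rewrite lastI rcons_uniq /= => /andP[-> ->] //.
exists (x :: q); split; last 1 first.
- by move=> y; rewrite inE => /predU1P[->|/Sq]; rewrite ?eqxx.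
- have cyc : path.cycle followed (x :: q).
    rewrite /=; have foll u v : vertex M (opp M u) = vertex M v -> followed u v.
      by move=> E; rewrite /followed E porbit_id.
    suff chain : forall q Q u v, map (vertex M) q = belast (vertex M (opp M u)) Q ->
        map (vertex M \o opp M) q = Q -> last (vertex M (opp M u)) Q = vertex M v ->
        path followed u (rcons q v) by apply: (chain _ Q).
    elim=> [|w r IH] [|V R] //= u v; first by move=> _ _ /foll->.
    case=> Ew sr [Ev tr] E; rewrite foll //=; apply: (IH R) => //; by rewrite Ev.
  have same_vertex u v : u \in x :: q -> v \in x :: q -> v \in vertex M u -> v = u.
    move=> uq vq uv; apply: (uniq_map_inj Usrc) => //.
    by apply/eqP; rewrite eq_porbit_mem.
  apply/and4P; split=> //; apply/allP => u uq; apply/negP => ouq.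
  (* If [u] and [opp M u] both lay on the cycle, each would be the successor of the other and [x]
     would be one of them; but [opp M x] is not on the cycle. *)
  have nextE v : v \in x :: q -> opp M v \in x :: q -> next (x :: q) v = opp M v.
    by move=> vq ovq; apply: same_vertex; rewrite ?mem_next //; exact: (next_cycle cyc vq).
  have := fconnect_cycle (cycle_next (map_uniq Usrc)) uq x.
  rewrite mem_head => /connectP[r + E].
  have : x = u \/ x = opp M u -> False.
    have xN : opp M x \in x :: q -> False.
      rewrite inE (negbTE (opp_neq M x)) /= => /Sq; by rewrite (negbTE oxS).
    by case=> Ex; apply: xN; rewrite [in opp M x]Ex // (oppK M).
  move=> xN rp; apply: xN.
  have : forall v, v = u \/ v = opp M u -> path (frel (next (x :: q))) v r ->
      last v r = u \/ last v r = opp M u.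
    elim: r {E rp} => //= w r IH v hv /andP[/eqP <-]; apply: IH.
    case: hv => ->; first by right; apply: nextE.
    by left; rewrite -[RHS](oppK M); apply: nextE; rewrite ?(oppK M).
  by move/(_ u (or_introl erefl) rp); rewrite -E.
- exact: mem_head.
Qed.

End Submaps.

(** * The search and the contour walk as iterated steps *)

Section Search.

Variables (n : nat) (M : plane_map n) (k : nat) (O : 'I_n -> 'I_k -> bool).
Local Notation dart := 'I_n.
Local Notation opp := (Defs.opp M).
Local Notation rot := (Defs.rot M).
Local Notation R := (root_face M).
Local Notation o := (outer_dart M).

Definition on_root_cycle (x : dart) := (x \in R) || (opp x \in R).

Definition search_state : Type := ({set dart} * dart * seq dart)%type.

(** The priority of crossing an edge over turning around the vertex, together with
    the sense of rotation, makes the search explore the right side of a path first.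
    The stack contains the darts crossed by the current path. *)
Definition search_step (s : search_state) : search_state :=
  let: (X, y, st) := s in
  if on_root_cycle y then s else
  if y \in X then
    if st is g :: st' then (X, (rot^-1)%g g, st') else s
  else if oriented_along O y then (y |: X, opp y, y :: st)
  else (y |: X, (rot^-1)%g y, st).

Definition search_start : search_state := (set0, (rot^-1)%g o, [::]).

(** A visit takes two off the first term and pushes at most one dart; a pop takes one off the
    second. *)
Definition search_measure (s : search_state) := 2 * #|~: s.1.1| + size s.2.

(** The contour walk, which discovers the forest: mark [0] stands for an edge not
    yet met, [1] for an edge of the forest and [2] for a cut edge. *)
Definition mark (m : dart -> nat) (y x : dart) : nat :=
  if (m y == 0) && ((x == y) || (x == opp y)) then
    if saturated O y then 2 else 1
  else m x.

Definition cut_step (s : (dart -> nat) * dart) : (dart -> nat) * dart :=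
  let m := mark s.1 s.2 in (m, rot (if m s.2 == 1 then opp s.2 else s.2)).

Lemma on_root_cycle_opp x : on_root_cycle (opp x) = on_root_cycle x.
Proof. by rewrite /on_root_cycle (oppK M) orbC. Qed.

End Search.

(** * The canonical forest and the root cycle *)

Section Forest.

Variables (n : nat) (M : plane_map n) (d k : nat) (O : 'I_n -> 'I_k -> bool).
Variable T : {set 'I_n}.
Hypotheses (d_ge3 : 3 <= d) (dangM : d_angulation M d).
Hypotheses (fracO : fractional_orientation M O) (canT : canonical_forest M O T).
Local Notation dart := 'I_n.
Local Notation opp := (Defs.opp M).
Local Notation rot := (Defs.rot M).
Local Notation R := (root_face M).
Implicit Types (x y z v : dart).

Lemma saturatedE x : saturated O x = ~~ oriented_along O (opp x).
Proof.
rewrite negb_exists; apply/forallP/forallP => h i.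
  by rewrite -(rev_ordK i) fracO.1 h.
have := h (rev_ord i); by rewrite fracO.1 negbK.
Qed.

(** The vertices of the root contour being distinct, an edge with the root face on both sides would
    close a contour of only two darts. *)
Lemma opp_root x : x \in R -> opp x \notin R.
Proof.
move=> xR; apply/negP => oxR.
have [[cardR inj] _ _ _] := dangM.
have nextR y : y \in R -> face_next M y \in R.
  by move=> yR; apply: porbit_trans yR (porbit_step _ _).
have vertexE y : vertex M (face_next M y) = vertex M (opp y).
  by apply/eqP; rewrite eq_porbit_mem /face_next permM porbit_step.
have next1 : face_next M x = opp x by apply: inj; rewrite ?nextR.
have next2 : face_next M (opp x) = x.
  by apply: inj; rewrite ?nextR // vertexE (oppK M).
have : R \subset [set x; opp x].
  apply/subsetP => y yR; have : y \in porbit (face_next M) x.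
    by apply: porbit_trans yR; rewrite porbit_sym.
  case/porbit_iterP=> i ->; elim: i => [|i]; first by rewrite !inE eqxx.
  by rewrite iterS !inE => /orP[]/eqP->; rewrite ?next1 ?next2 eqxx ?orbT.
move/subset_leq_card; rewrite cards2 eq_sym (opp_neq M) => hc.
by move: d_ge3; rewrite -cardR ltnNge hc.
Qed.

Lemma closedT : opp_closed M T.
Proof. by apply/opp_closedP; case: canT. Qed.

(** Both sides of an edge outside [T] lie in the same region, but only one side of [x] is the root
    face. *)
Lemma root_subT x : x \in R -> x \in T.
Proof.
move=> xR; apply: contraLR (opp_root xR) => xT; rewrite negbK.
have [_ two _ _ _] := canT.
have : same_region M (mem T) x (opp x).
  have oxT : opp x \notin T by rewrite (opp_closedP _ _ closedT).
  exact: same_region_cross.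
by rewrite two xR => /eqP <-.
Qed.

Lemma root_face_next x : x \in R -> face_next M x \in R.
Proof. by move=> xR; apply: porbit_trans xR (porbit_step _ _). Qed.

Lemma linked_root (S : {set dart}) x y : {subset R <= S} -> x \in R -> y \in R ->
  linked M S x y.
Proof.
move=> sub xR yR; have : y \in porbit (face_next M) x.
  by apply: porbit_trans yR; rewrite porbit_sym.
case/porbit_iterP=> i ->; elim: i => [|i IH]; first exact: connect0.
have iR j : iter j (face_next M) x \in R.
  by elim: j => // j; rewrite iterS; apply: root_face_next.
apply: linked_trans IH _; rewrite iterS /face_next permM.
exact: linked_trans (linked_opp _ (sub _ (iR i))) (linked_rot _ _ _).
Qed.

(** The oriented path of [T] to the root cycle can only use edges of [S], hence stays in the
    component of [x]. *)
Lemma accessible_linked (S : {set dart}) x :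
  (forall u, linked M S x u -> u \in T -> oriented_along O u -> u \in S) ->
  exists2 y, y \in R & linked M S x y.
Proof.
move=> h; have [_ _ acc _ _] := canT; have [y] := acc x.
case/existsP=> z /andP[zy zR] /connectP[q pq Ey]; exists z => //.
suff lxy : linked M S x y by apply: linked_trans lxy (linked_vertex _ zy).
have : linked M S x x by apply: connect0.
rewrite {z zR zy Ey}(Ey : y = last x q).
elim: q {1 3 5}x pq => //= v q IH u /andP[/orP[uv|/and3P[uT ou /eqP Ev]] pq] lu.
  by apply: (IH v) => //; apply: linked_trans lu (linked_vertex _ uv).
apply: (IH v) => //; rewrite Ev; have uS := h _ lu uT ou.
exact: linked_trans lu (linked_opp _ uS).
Qed.

Lemma linked_T x y : linked M T x y.
Proof.
have [|x' x'R lx] := @accessible_linked T x; first by [].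
have [|y' y'R ly] := @accessible_linked T y; first by [].
apply: linked_trans lx (linked_trans (linked_root root_subT x'R y'R) _).
by rewrite /linked linked_sym //; apply: closedT.
Qed.

(** ** Positions along the contour of the forest *)

Local Notation o := (outer_dart M).
Definition walk := contour M T.
Local Notation w := walk.

Lemma walkE x : w x = rot (if x \in T then opp x else x).
Proof. by rewrite /walk contourE ?closedT. Qed.

Lemma outer_notin_root : o \notin R.
Proof.
have [_ _ _ neq] := dangM; apply: contra neq => oR.
by rewrite /outer_face /face eq_porbit_mem porbit_sym.
Qed.

(** As [T] is connected, its contours are its regions; so a single contour remains besides the root
    face, and it also passes the stems of the cut edges. *)
Lemma walk_orbit x : (x \in porbit w o) = (x \notin R).
Proof.
have [_ two _ _ _] := canT.
have reg y : same_region M (mem T) o y = (y \notin R).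
  by rewrite two (negbTE outer_notin_root) -[RHS]eqbF_neg eq_sym.
rewrite -reg; apply/idP/idP.
  by apply: contour_region closedT _ => y.
apply: region_contour closedT _ _; first by move=> y.
by move=> y yT _; apply: linked_same_face closedT yT (linked_T _ _).
Qed.

Definition walk_length := #|porbit w o|.
Local Notation N := walk_length.
Definition at_pos i := iter i w o.
Local Notation p := at_pos.
(** The default value [N] is taken on the root face, which the walk never meets. *)
Definition pos x := index x (traject w o N).

Lemma at_pos_length : p N = o.
Proof. exact: iter_porbit. Qed.

Lemma walk_length_gt0 : 0 < N.
Proof. by rewrite lt0n card_porbit_neq0. Qed.

Lemma walk_length_le : N <= n.
Proof. by rewrite -[X in _ <= X]card_ord max_card. Qed.

Lemma pos_lt x : x \notin R -> pos x < N.
Proof.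
by rewrite -walk_orbit porbit_traject -index_mem size_traject.
Qed.

Lemma posK x : x \notin R -> p (pos x) = x.
Proof.
move=> xR; have := pos_lt xR; move/(nth_traject w)/(_ o); rewrite /at_pos => <-.
by apply: nth_index; rewrite -porbit_traject walk_orbit.
Qed.

Lemma at_posK i : i < N -> pos (p i) = i.
Proof.
move=> ltiN; rewrite /pos /at_pos -(nth_traject w ltiN) index_uniq ?size_traject //.
exact: uniq_traject_porbit.
Qed.

Lemma pos_inj x y : x \notin R -> y \notin R -> pos x = pos y -> x = y.
Proof. by move=> xR yR E; rewrite -(posK xR) E posK. Qed.

Lemma pos_outer : pos o = 0.
Proof. by rewrite -[o]/(p 0) at_posK // walk_length_gt0. Qed.

Lemma walk_at_pos i : w (p i) = p i.+1.
Proof. by []. Qed.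

(** The transposition cuts the walk into two arcs. By [contourU], this is the effect of adding the
    edge of a stem as well as of deleting an edge of [T]. *)
Lemma split_inside (a b : dart) i : a \notin R -> b \notin R ->
  pos a < i <= pos b -> p i \in porbit (tperm a b * w)%g b.
Proof.
move=> aR bR /andP[]; have ltb := pos_lt bR.
elim: i => // i IH; rewrite ltnS leq_eqVlt => /predU1P[<- _|lti ltib].
  by have := porbit_step (tperm a b * w)%g b; rewrite permM tpermR -walk_at_pos posK.
apply: porbit_trans (IH lti (ltnW ltib)) _.
have := porbit_step (tperm a b * w)%g (p i).
rewrite permM tpermD ?walk_at_pos //; apply/eqP => E.
  by have := lti; rewrite E at_posK ?ltnn // (ltn_trans ltib ltb).
by have := ltib; rewrite E at_posK ?ltnn // (ltn_trans ltib ltb).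
Qed.

Lemma split_outside (a b : dart) i : a \notin R -> b \notin R ->
  pos a < pos b -> i < N -> (i <= pos a) || (pos b < i) ->
  p i \in porbit (tperm a b * w)%g a.
Proof.
move=> aR bR ltab ltiN; have ltb := pos_lt bR.
have pN j : p (N + j) = p j by rewrite /p addnC iterD [iter N w o]at_pos_length.
(* This arc runs through [o], so its positions are counted on beyond [N]. *)
have main j : pos b < j <= N + pos a -> p j \in porbit (tperm a b * w)%g a.
  case/andP; elim: j => // j IH; rewrite ltnS leq_eqVlt => /predU1P[<- _|ltj ltja].
    by have := porbit_step (tperm a b * w)%g a; rewrite permM tpermL -walk_at_pos posK.
  apply: porbit_trans (IH ltj (ltnW ltja)) _.
  have := porbit_step (tperm a b * w)%g (p j).
  have posj : pos (p j) = j /\ j < N \/ pos (p j) = j - N /\ N <= j.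
    have [ltjN|leNj] := ltnP j N; first by left; rewrite at_posK.
    by right; split=> //; rewrite -{1}(subnKC leNj) pN at_posK //; lia.
  rewrite permM tpermD ?walk_at_pos //; apply/eqP => E; rewrite -E in posj; lia.
case/orP=> h; last by apply: main; lia.
by rewrite -pN; apply: main; lia.
Qed.

(** A cut edge is met first at its origin: otherwise it would separate the outer
    face from its left side. *)
Lemma pos_cut x : x \notin T -> saturated O x -> pos x < pos (opp x).
Proof.
move=> xT satx; have oxT : opp x \notin T by rewrite (opp_closedP _ _ closedT).
have xR : x \notin R by apply: contra xT; apply: root_subT.
have oxR : opp x \notin R by apply: contra oxT; apply: root_subT.
rewrite ltnNge leq_eqVlt; apply/negP => /predU1P[/pos_inj E|ltpos].
  by have := opp_neq M x; rewrite E ?eqxx.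
have [q [cq xq qT]] := simple_cycle_through xT oxT (linked_T _ _).
have [_ _ _ _ /(_ x xT satx q cq xq qT)] := canT.
case/hasP=> z zq zo; have := jordan cq xq; apply/negP; rewrite negbK.
apply: same_region_trans (same_region_cycle cq xq zq) _.
apply: same_region_trans zo _.
apply: (@contour_region _ _ _ (edge M x :|: T)).
- exact: opp_closedU closedT.
- move=> y yq; rewrite inE in_edge; have [//|/(qT y yq)->] := eqVneq y x.
  by rewrite orbT.
(* Adding the edge cuts the walk into two arcs; with [opp x] met first, position 0 falls on the arc
   of [opp x]. *)
rewrite contourU //; last exact: closedT.
rewrite tpermC porbit_sym -[o]/(p 0); apply: split_outside => //.
exact: walk_length_gt0.
Qed.

(** ** The two sides of an edge of the forest *)

(** Both sides lie on the outer contour, so the edge disconnects [T]; the order of the positions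
    makes [v] point away from the outer vertex. *)
Definition bridge v := [&& v \in T, v \notin R, opp v \notin R & pos v < pos (opp v)].
Definition side v x := linked M (T :\: edge M v) (opp v) x.

Lemma side_vertex v x y : y \in vertex M x -> side v x -> side v y.
Proof. by move=> xy h; apply: linked_trans h (linked_vertex _ xy). Qed.

Lemma side_rot v x : side v (rot x) = side v x.
Proof.
apply/idP/idP; apply: side_vertex; last exact: porbit_step.
by rewrite /vertex porbit_sym porbit_step.
Qed.

Lemma side_opp v x : x \in T -> x != v -> x != opp v -> side v (opp x) = side v x.
Proof.
move=> xT xv xov; have xS : x \in T :\: edge M v.
  by rewrite inE in_edge negb_or xv xov.
have oxS : opp x \in T :\: edge M v.
  by rewrite (opp_closedP _ _ (opp_closedD v closedT)).
apply/idP/idP => h; last exact: linked_trans h (linked_opp _ xS).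
by apply: linked_trans h _; have := linked_opp M oxS; rewrite (oppK M).
Qed.

Lemma side_self v : side v (opp v).
Proof. exact: connect0. Qed.

Lemma sideN v : bridge v -> side v v = false.
Proof.
case/and4P=> vT vR ovR ltv; apply/negbTE.
rewrite /side /linked linked_sym; last exact: opp_closedD closedT.
rewrite -/(linked _ _ _ _) -same_face_unlinked //; last exact: closedT.
by apply: (@porbit_trans _ w _ o); rewrite ?walk_orbit // porbit_sym walk_orbit.
Qed.

(** Deleting the edge separates the part of the walk between the two passages along it from the
    rest. *)
Lemma sideE v x : bridge v -> x \notin R ->
  side v x = (pos v < pos x <= pos (opp v)).
Proof.
move=> bv xR; have /and4P[vT vR ovR ltv] := bv.
have cD := opp_closedD v closedT.
have wE : contour M (T :\: edge M v) = (tperm v (opp v) * w)%g.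
  have vD : v \notin T :\: edge M v by rewrite !inE eqxx.
  have := contourU cD vD; rewrite edgeK // ?closedT // /w => ->.
  by rewrite mulgA tperm2 mul1g.
apply/idP/idP => [|h]; last first.
  by apply: linked_contour => //; rewrite wE -(posK xR); apply: split_inside.
apply: contraTT => h; apply/negP => sx; have /negP[] : ~~ side v v by rewrite sideN.
apply: linked_trans sx _; rewrite /linked linked_sym //.
apply: linked_contour => //; rewrite wE -(posK xR).
by apply: split_outside => //; [exact: pos_lt|move: h; lia].
Qed.

Lemma side_outer v : bridge v -> side v o = false.
Proof. by move=> bv; rewrite sideE ?outer_notin_root // pos_outer. Qed.

Lemma side_root v x y : bridge v -> x \in R -> y \in R -> side v x -> side v y.
Proof.
case/and4P=> vT vR ovR _ xR yR sx; apply: linked_trans sx (linked_root _ xR yR).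
move=> z zR; rewrite inE root_subT // andbT in_edge; apply/norP.
by split; apply/eqP => E; [move: vR|move: ovR]; rewrite -E zR.
Qed.

(** From the near side, the oriented path to the root cycle has to cross the edge along [v]. *)
Lemma side_root_oriented v x : bridge v -> x \in R -> side v x ->
  oriented_along O v.
Proof.
move=> bv xR sx; apply: contraFT (sideN bv) => ov.
have cD := opp_closedD v closedT.
have [|y yR ly] := @accessible_linked (T :\: edge M v) v.
  move=> u lu uT ou; rewrite inE uT andbT in_edge; apply/norP; split.
    by apply: contraNneq ov => <-.
  apply/eqP => Eu; have /negP[] : ~~ side v v by rewrite sideN.
  by rewrite /side /linked linked_sym // -Eu.
apply: linked_trans (side_root bv xR yR sx) _.
by rewrite /linked linked_sym.
Qed.

(** No oriented path comes back across a saturated edge, so the far side must hold the root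
    cycle. *)
Lemma side_saturated v x : bridge v -> x \in R -> saturated O v -> side v x.
Proof.
rewrite saturatedE => bv xR ov.
have [|y yR ly] := @accessible_linked (T :\: edge M v) (opp v); last exact: side_root ly.
move=> u lu uT ou; rewrite inE uT andbT in_edge; apply/norP; split.
  by apply/eqP => Eu; move: lu; rewrite Eu -/(side v v) sideN.
by apply: contraNneq ov => <-.
Qed.

(** * The path from the outer vertex to the root cycle *)

Local Notation target := (on_root_cycle M).
Local Notation turn := (rot^-1)%g.
Implicit Types (g r : dart) (X : {set dart}) (st : seq dart).

Lemma opp_inT x : (opp x \in T) = (x \in T).
Proof. exact: (opp_closedP _ _ closedT). Qed.

Lemma cut_notin_root x : x \notin T -> x \notin R.
Proof. by apply: contra; apply: root_subT. Qed.

Lemma targetN x : ~~ target x -> (x \notin R) && (opp x \notin R).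
Proof. by rewrite negb_or. Qed.

Lemma target_inT x : target x -> x \in T.
Proof. by case/orP=> /root_subT; rewrite ?opp_inT. Qed.

Lemma bridge_target v : bridge v -> ~~ target v.
Proof. by case/and4P=> _ h1 h2 _; rewrite negb_or h1 h2. Qed.

Lemma bridge_neq_opp v x : bridge v -> bridge x -> x != opp v.
Proof.
case/and4P=> _ _ _ h1 /and4P[_ _ _ h2]; apply/eqP => E.
by move: h2; rewrite E (oppK M) ltnNge ltnW.
Qed.

Lemma bridge_or_opp x : x \in T -> ~~ target x ->
  bridge x \/ bridge (opp x) /\ pos (opp x) < pos x.
Proof.
move=> xT /targetN/andP[xR oxR]; rewrite /bridge opp_inT (oppK M) xT xR oxR /=.
case: ltngtP => [h|h|E]; [by left|by right|].
by have := opp_neq M x; rewrite -(pos_inj xR oxR E) eqxx.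
Qed.

Lemma turnK x : rot (turn x) = x. Proof. exact: permKV. Qed.

Lemma side_turn v x : side v (turn x) = side v x.
Proof. by rewrite -(side_rot v (turn x)) turnK. Qed.

(** The edges of the path of the forest from the outer vertex to the root. *)
Definition rising v := bridge v && [exists r in R, side v r].

(** The outer contour meets an edge of the root cycle at the opposite of a dart of [R], so lying on
    the path becomes a matter of positions. *)
Lemma rising_pos v : rising v ->
  exists r, [/\ target r, r \notin R & pos v < pos r <= pos (opp v)].
Proof.
case/andP=> bv /existsP[r /andP[rR sr]]; exists (opp r).
have orR := opp_root rR.
have /and4P[_ vR ovR _] := bv.
rewrite on_root_cycle_opp /target rR; split=> //.
rewrite -sideE //; rewrite side_opp ?root_subT //.
  by apply: contraNneq vR => <-.
by apply: contraNneq ovR => <-.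
Qed.

Lemma pos_rising v r : bridge v -> target r -> r \notin R ->
  pos v < pos r <= pos (opp v) -> rising v.
Proof.
move=> bv tr rR hr; rewrite /rising bv; apply/existsP; exists (opp r).
have oR : opp r \in R by case/orP: tr => //; rewrite (negbTE rR).
have /and4P[_ vR ovR _] := bv.
rewrite oR side_opp ?sideE ?target_inT //.
  by apply: contraNneq ovR => <-.
by apply: contraNneq vR => E; rewrite -(oppK M v) -E.
Qed.

Lemma root_target : exists r, target r /\ r \notin R.
Proof.
exists (opp (root_dart M)); have rR : root_dart M \in R by apply: porbit_id.
rewrite on_root_cycle_opp /target rR; split=> //.
exact: opp_root rR.
Qed.

Lemma at_pos_pred x h : 0 < h <= N -> x \notin R -> w x = p h -> pos x = h.-1.
Proof.
case: h => // h /= leh xR E.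
have : x = p h by apply: (@perm_inj _ w); rewrite E.
by move->; rewrite at_posK.
Qed.

(** [z] is a dart of a vertex of the path from the outer vertex to the root,
    which is reached after the edges of [st]; the darts preceding [z] on its right
    have positions at least [h]. *)
Record frontier st z h : Prop := Frontier {
  front_st : forall g, g \in st -> rising g /\ side g z;
  front_le : h <= N;
  front_target : forall r, target r -> r \notin R -> pos r < h;
  front_side : forall v, bridge v -> side v z -> v \in st;
  front_pos : ~~ target z ->
    pos z < h /\ (h.-1 = pos z \/ bridge z /\ h.-1 = pos (opp z))
}.

(** The contour reaches [p h] from [z] or, if [z] is in [T], from [opp z]. In that case [opp z] is
    not a bridge: it would belong to [st], and a target would follow it, at position [h] or
    later. *)
Lemma frontier_pos st z h : 0 < h <= N ->
  (forall g, g \in st -> rising g) ->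
  (forall r, target r -> r \notin R -> pos r < h) ->
  (forall v, bridge v -> side v z -> v \in st) ->
  rot z = p h -> ~~ target z ->
  pos z < h /\ (h.-1 = pos z \/ bridge z /\ h.-1 = pos (opp z)).
Proof.
move=> hh frst frt frs E tz; have /andP[zR ozR] := targetN tz.
have [zT|zT] := boolP (z \in T); last first.
  have := @at_pos_pred z h hh zR; rewrite walkE (negbTE zT) => /(_ E) Ez.
  by rewrite Ez; split; [lia|left].
have := @at_pos_pred (opp z) h hh ozR; rewrite walkE opp_inT zT (oppK M) => /(_ E) Ez.
case: (bridge_or_opp zT tz) => [bz|[bz ltz]].
  have /and4P[_ _ _ ltz] := bz; split; [lia|by right].
have /frst/rising_pos[r [tr rR /andP[h1 h2]]] : opp z \in st.
  by apply: frs => //; have := side_self (opp z); rewrite (oppK M).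
by have := frt r tr rR; lia.
Qed.

(** A bridge off the path has no target between its two passages, so all targets come before [z] and
    the bound drops to [pos z]. *)
Lemma frontier_turn st z h : frontier st z h -> ~~ target z -> ~~ rising z ->
  frontier st (turn z) (pos z).
Proof.
move=> fr tz rz; have /andP[zR _] := targetN tz.
have frt r : target r -> r \notin R -> pos r < pos z.
  move=> tr rR; have := front_target fr tr rR.
  have neq : pos r <> pos z.
    by move/(pos_inj rR zR) => E; rewrite E (negbTE tz) in tr.
  case: (front_pos fr tz) => ltz [Eh|[bz Eh]] ltr; first by lia.
  rewrite ltnNge; apply: contra rz => lez; apply: (pos_rising bz tr rR); lia.
have frst g : g \in st -> rising g /\ side g (turn z).
  by move=> gst; rewrite side_turn; exact: (front_st fr gst).
have frs v : bridge v -> side v (turn z) -> v \in st.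
  by move=> bv; rewrite side_turn; apply: (front_side fr bv).
have ltz := pos_lt zR.
split=> //; first exact: ltnW.
apply: (frontier_pos _ _ frt frs) => //.
- have [r [tr rR]] := root_target; have := frt r tr rR; lia.
- by move=> g /frst[].
- by rewrite turnK posK.
Qed.

Lemma frontier_notin st z h : frontier st z h -> ~~ target z -> z \notin st.
Proof.
by move=> fr tz; apply/negP => zst; have [/andP[bz _]] := front_st fr zst; rewrite sideN.
Qed.

Lemma frontier_cross st z h : frontier st z h -> rising z ->
  frontier (z :: st) (opp z) h.
Proof.
move=> fr rz; have /andP[bz _] := rz; have tz := bridge_target bz.
have zst := frontier_notin fr tz; have /and4P[zT zR ozR ltz] := bz.
have sideZ v : bridge v -> v != z -> side v (opp z) = side v z.
  move=> bv vz; apply: side_opp => //; first by rewrite eq_sym.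
  exact: bridge_neq_opp.
split.
- move=> g; rewrite inE => /predU1P[->|gst]; first by rewrite side_self.
  have [rg sg] := front_st fr gst; have /andP[bg _] := rg.
  by rewrite sideZ //; apply: contraNneq zst => <-.
- exact: front_le fr.
- exact: front_target fr.
- move=> v bv; rewrite inE; have [//|vz] := eqVneq v z.
  by rewrite sideZ //; apply: (front_side fr bv).
- move=> _; have [r [tr rR /andP[h1 h2]]] := rising_pos rz.
  have := front_target fr tr rR; case: (front_pos fr tz) => ltzh [Eh|[_ Eh]] ltr.
    by lia.
  split; [by lia|by left].
Qed.

(** * Excursions of the search off the path, its invariant and its termination *)

Section Excursion.

Variables (st : seq dart) (z : dart) (h : nat).
Hypotheses (fr : frontier st z h) (tz : ~~ target z) (rz : ~~ rising z).

Definition beyond (x : dart) := (x \notin R) && (pos z < pos x).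

Lemma beyond_target x : beyond x -> ~~ target x.
Proof.
case/andP=> xR ltx; apply/negP => tx.
by have := front_target (frontier_turn fr tz rz) tx xR; lia.
Qed.

Variable X : {set dart}.
Hypotheses (zX : z \in X) (stX : {subset st <= X}).

(** A dart of the forest met before [z], whose opposite is not, has [z] on its far side; so it is in
    [st] and has been visited. *)
Lemma beyond_or x : x \notin R -> x \in T -> pos z <= pos (opp x) ->
  ~~ target x -> beyond x || (x \in X).
Proof.
move=> xR xT lex tx; have /andP[zR _] := targetN tz; rewrite /beyond xR /=.
case: ltngtP => //= [ltx|E]; last by rewrite -(pos_inj zR xR E).
apply: stX; have bx : bridge x.
  by rewrite /bridge xT xR; case/andP: (targetN tx) => _ -> /=; lia.
by apply: (front_side fr bx); rewrite sideE // ltx lex.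
Qed.

(** A cut edge leads further along the contour by [pos_cut], and an edge of the forest falls under
    [beyond_or]. *)
Lemma beyond_opp x : beyond x -> oriented_along O x -> beyond (opp x) || (opp x \in X).
Proof.
move=> bx ox; have /andP[xR ltx] := bx; have tx := beyond_target bx.
have /andP[_ oxR] := targetN tx.
have [xT|xT] := boolP (x \in T).
  apply: beyond_or => //; rewrite ?opp_inT ?on_root_cycle_opp //.
  by rewrite [opp (opp x)](oppK M) ltnW.
have satx : saturated O x.
  have [_ _ _ /(_ x xT)/orP[//|sat] _] := canT.
  by rewrite saturatedE (oppK M) ox in sat.
have := pos_cut xT satx; rewrite /beyond oxR /= => /(ltn_trans ltx)->.
by [].
Qed.

(** The contour reaches [x] from [turn x] or from its opposite, at the position just before that of
    [x], hence not before [z]. *)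
Lemma beyond_turn x : beyond x -> beyond (turn x) || (turn x \in X).
Proof.
case/andP=> xR ltx; have /andP[zR _] := targetN tz.
have ltxN := pos_lt xR.
have xE : p (pos x) = x by apply: posK xR.
have hx : 0 < pos x <= N by lia.
set v := turn x; have rv : rot v = x by apply: turnK.
have [vT|vT] := boolP (v \in T); last first.
  have vR := cut_notin_root vT; have : pos v = (pos x).-1.
    by apply: at_pos_pred => //; rewrite walkE (negbTE vT) rv xE.
  move=> E; rewrite /beyond vR /=; case: ltngtP => //= [|E2]; first by lia.
  by rewrite -(pos_inj zR vR E2).
have wv : w (opp v) = p (pos x) by rewrite walkE opp_inT vT (oppK M) rv xE.
have ovR : opp v \notin R.
  apply: contra xR => ovR.
  have := root_face_next ovR; by rewrite /face_next permM (oppK M) rv.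
have E : pos (opp v) = (pos x).-1 by apply: at_pos_pred.
have tv : ~~ target (opp v).
  apply/negP => tv; have := front_target (frontier_turn fr tz rz) tv ovR; lia.
rewrite on_root_cycle_opp in tv; have /andP[vR _] := targetN tv.
by apply: beyond_or => //; lia.
Qed.

End Excursion.

(** Either the search stands at the frontier [z] of the path, or it has tried the edge of [z], which
    is off the path, and sees only darts beyond [z] or visited ones. In the latter phase [z] stays
    on the stack below [junk], so the search has to backtrack to it. *)
Definition search_inv (s : search_state n) :=
  let: (X, y, st0) := s in
  exists st z h, [/\ frontier st z h, {subset st <= X} &
    [/\ y = z, st0 = st &
      forall x, x \in X -> (x \in st) \/ x \notin R /\ h <= pos x] \/
    [/\ ~~ target z, ~~ rising z, z \in X,
      forall x, x \in X -> [\/ x \in st, x = z | beyond z x] &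
      exists2 junk, st0 = junk ++ z :: st &
        {in junk, forall x, beyond z x} /\ beyond z y || (y \in X)]].

Lemma search_inv_start : search_inv (search_start M).
Proof.
exists [::], (turn o), N; split=> //; last by left; split=> // x; rewrite inE.
have frt r : target r -> r \notin R -> pos r < N by move=> _; apply: pos_lt.
have frs v : bridge v -> side v (turn o) -> v \in [::].
  by move=> bv; rewrite side_turn side_outer.
split=> //; apply: (frontier_pos _ _ frt frs) => //.
  by rewrite walk_length_gt0 /=.
by rewrite turnK at_pos_length.
Qed.

Lemma setC_visit X y : y \notin X -> #|~: (y |: X)|.+1 = #|~: X|.
Proof.
move=> yX; rewrite [RHS](cardsD1 y) inE yX add1n; congr _.+1; apply: eq_card => x.
by rewrite !inE negb_or.
Qed.

Lemma search_inv_step s : search_inv s -> ~~ target s.1.2 ->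
  search_inv (search_step M O s) /\
  search_measure (search_step M O s) < search_measure s.
Proof.
case: s => [[X y] st0] /= [st [z [h [fr stX inv]]]] ty; rewrite (negbTE ty).
have meas_push st1 y' : y \notin X -> size st1 <= (size st0).+1 ->
    search_measure (y |: X, y', st1) < search_measure (X, y, st0).
  move=> yX sz.
    suff : 2 * #|~: (y |: X)| + size st1 < 2 * #|~: X| + size st0 by [].
    by rewrite -(setC_visit yX); lia.
case: inv => [[Ey Est subX]|[tz rz zX subX [junk Est [subj hy]]]].
  subst y st0; have zst := frontier_notin fr ty.
  have /andP[zR _] := targetN ty; have [ltz _] := front_pos fr ty.
  have zX : z \notin X.
    by apply/negP => /subX[|[_]]; [rewrite (negbTE zst)|rewrite leqNgt ltz].
  have stX' : {subset st <= z |: X} by move=> x /stX; rewrite inE orbC => ->.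
  (* An edge of the path is oriented along [z], so the search crosses it for good; another edge is
     skipped or starts an excursion with empty [junk]. *)
  rewrite (negbTE zX); have [rz|rz] := boolP (rising z).
    have /andP[bz /existsP[r /andP[rR sr]]] := rz.
    rewrite (side_root_oriented bz rR sr); split; last exact: meas_push.
    exists (z :: st), (opp z), h; split; first exact: frontier_cross.
      by move=> x; rewrite inE => /predU1P[->|/stX'] //; rewrite !inE eqxx.
    left; split=> // x; rewrite !inE => /orP[->|/subX[->|]]; rewrite ?orbT; try by left.
    by right.
  have subX' x : x \in z |: X -> [\/ x \in st, x = z | beyond z x].
    rewrite !inE => /predU1P[->|/subX[xst|[xR hx]]]; first by constructor 2.
      by constructor 1.
    by constructor 3; rewrite /beyond xR (leq_trans ltz).
  have zX' : z \in z |: X by rewrite !inE eqxx.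
  have [oz|oz] := boolP (oriented_along O z); split; try exact: meas_push.
    exists st, z, h; split=> //; right; split=> //; exists [::] => //; split=> //.
    have /andP[_ ozR] := targetN ty.
    have [zT|zT] := boolP (z \in T).
      apply: (@beyond_or st z h) => //; first by rewrite opp_inT.
        by rewrite (oppK M).
      by rewrite on_root_cycle_opp.
    have satz : saturated O z.
      have [_ _ _ /(_ z zT)/orP[//|sat] _] := canT.
      by rewrite saturatedE (oppK M) oz in sat.
    by have := pos_cut zT satz; rewrite /beyond ozR /= => ->.
  exists st, (turn z), (pos z); split=> //; first exact: frontier_turn fr ty rz.
  left; split=> // x /subX'[xst|->|/andP[xR ltx]]; first by left.
    by right.
  by right; split=> //; apply: ltnW.
have [yX|yX] := boolP (y \in X).
  (* Once [junk] is exhausted, [z] itself is popped and the search resumes on the path at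
     [turn z]. *)
  rewrite Est; case: junk => [|g junk] in Est subj * => /=.
    split; last by rewrite /search_measure /=; lia.
    exists st, (turn z), (pos z); split=> //; first exact: frontier_turn fr tz rz.
    left; split=> // x /subX[xst|->|/andP[xR ltx]]; first by left.
      by right; split=> //; case/andP: (targetN tz).
    by right; split=> //; apply: ltnW.
  split; last by rewrite /search_measure /=; lia.
  exists st, z, h; split=> //; right; split=> //; exists junk => //; split.
    by move=> x xj; apply: subj; rewrite inE xj orbT.
  by apply: (beyond_turn fr) => //; apply: subj; rewrite mem_head.
rewrite (negbTE yX) orbF in hy.
have stX' : {subset st <= y |: X} by move=> x /stX; rewrite inE orbC => ->.
have zX' : z \in y |: X by rewrite inE zX orbT.
have subX' x : x \in y |: X -> [\/ x \in st, x = z | beyond z x].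
  by rewrite !inE => /predU1P[->|/subX //]; constructor 3.
have [oy|oy] := boolP (oriented_along O y); split.
- exists st, z, h; split=> //; right; split=> //; exists (y :: junk); first by rewrite Est.
  split; first by move=> x; rewrite inE => /predU1P[->|/subj].
  exact: (beyond_opp fr).
- exact: meas_push.
- exists st, z, h; split=> //; right; split=> //; exists junk; first by [].
  by split=> //; apply: (beyond_turn fr).
- exact: meas_push.
Qed.

Definition search_end := iter (2 * n) (search_step M O) (search_start M).

Lemma search_end_inv : search_inv search_end /\ target search_end.1.2.
Proof.
have step i : let s := iter i (search_step M O) (search_start M) in
    search_inv s /\ (target s.1.2 \/ search_measure s + i <= 2 * n).
  elim: i => [|i [IH1 IH2]].
    split; first exact: search_inv_start.
    by right; rewrite /search_measure /= !addn0 leq_mul2l -[X in _ <= X]card_ord max_card.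
  rewrite iterS; move: IH1 IH2; set s := iter i _ _ => IH1 IH2.
  have [ts|ts] := boolP (target s.1.2).
    have -> : search_step M O s = s by case: (s) ts => [[X y] st] /= ->.
    by split=> //; left.
  have [h1 h2] := search_inv_step IH1 ts; split=> //; right.
  by case: IH2 => [h|]; [rewrite h in ts|lia].
(* Without a target so far the measure would be 0, yet a further step would decrease it. *)
have [inv [//|le]] := step (2 * n); split=> //.
apply/negPn/negP => ts; have [_] := search_inv_step inv ts; rewrite -/search_end in le *.
lia.
Qed.

(** During an excursion no visited dart and no dart beyond [z] is a target, so the search ends on
    the path. *)
Lemma search_end_frontier : exists z h, frontier search_end.2 z h /\ target z.
Proof.
have [] := search_end_inv; case: search_end => [[X y] st0] /=.
case=> st [z [h [fr stX [[-> -> _]|[tz rz zX subX [junk Est [subj hy]]]]]]] ty.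
  by exists z, h.
case/orP: hy => [hy|/subX[yst|yz|hy]].
- by have := beyond_target fr tz rz hy; rewrite ty.
- have [/andP[/bridge_target]] := front_st fr yst; by rewrite ty.
- by rewrite -yz ty in tz.
- by have := beyond_target fr tz rz hy; rewrite ty.
Qed.

Lemma search_end_bridge g : g \in search_end.2 -> bridge g.
Proof.
have [z [h [fr _]]] := search_end_frontier.
by move=> gst; have [/andP[]] := front_st fr gst.
Qed.

(** The far side holds the root cycle, hence the vertex where the search ends, and the stack
    contains every bridge separating this vertex from the outer one. *)
Lemma search_end_saturated v : bridge v -> saturated O v -> v \in search_end.2.
Proof.
have [z [h [fr tz]]] := search_end_frontier.
move=> bv satv; apply: (front_side fr bv).
have sR r : r \in R -> side v r by move=> rR; apply: side_saturated bv rR satv.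
case/orP: (tz) => [/sR //|ozR]; have /and4P[_ vR ovR _] := bv.
rewrite -side_opp ?target_inT ?sR //.
  by apply: contraNneq ovR => <-.
by apply: contraNneq vR => E; rewrite -(oppK M v) -E.
Qed.

(** * The contour walk recovers the forest *)

Definition cut_start (m : dart -> nat) := forall x,
  m x = [|| target x, x \in search_end.2 | opp x \in search_end.2].

Lemma cut_walk m : cut_start m ->
  forall x, (iter n (cut_step M O) (m, o)).1 x = if x \in T then 1 else 2.
Proof.
move=> m0E.
have m0T x : m x = 1 -> x \in T.
  rewrite m0E; case/orP: (orbN (target x)) => [/target_inT //|/negbTE-> /=].
  have stT g : g \in search_end.2 -> g \in T by case/search_end_bridge/and4P.
  by case: (boolP (x \in _)) => [/stT //|_]; case: (boolP (opp x \in _)) => [/stT|//];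
    rewrite opp_inT.
have m0opp x : m (opp x) = m x.
  by rewrite !m0E on_root_cycle_opp (oppK M); congr (nat_of_bool (_ || _)); rewrite orbC.
pose inv i (s : (dart -> nat) * dart) := [/\ s.2 = p i, forall x, s.1 (opp x) = s.1 x,
  forall x, [\/ s.1 x = 0, s.1 x = 1 /\ x \in T | s.1 x = 2 /\ x \notin T],
  forall x, m x = 1 -> s.1 x = 1 & forall j, j < i -> s.1 (p j) != 0].
have step i s : inv i s -> inv i.+1 (cut_step M O s).
  case: s => m1 y [/= Ey m1opp m1T m1m m1p].
  suff [h1 h2 h3 h4] : [/\ forall x, mark M O m1 y (opp x) = mark M O m1 y x,
      forall x, [\/ mark M O m1 y x = 0, mark M O m1 y x = 1 /\ x \in T
        | mark M O m1 y x = 2 /\ x \notin T],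
      forall x, m1 x <> 0 -> mark M O m1 y x = m1 x & mark M O m1 y y != 0].
    split.
    - change (rot (if mark M O m1 y y == 1 then opp y else y) = p i.+1).
      rewrite -walk_at_pos -Ey walkE; case: (h2 y) => [E|[-> ->] //|[-> /negbTE->] //].
      by rewrite E in h4.
    - exact: h1.
    - exact: h2.
    - by move=> x mx; rewrite -(m1m x mx); apply: h3; rewrite m1m.
    - move=> j; rewrite ltnS leq_eqVlt => /predU1P[->|ltji]; first by rewrite -Ey.
      have mj := m1p j ltji.
      by move: (mj); rewrite -(h3 (p j) (elimN eqP mj)).
  rewrite /mark; have [my|my] := eqVneq (m1 y) 0; last by split=> // x; rewrite m1opp.
  rewrite /= eqxx /=.
  have ty : ~~ target y by apply/negP => ty; have := m1m y; rewrite m0E ty my => /(_ erefl).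
  have /andP[yR oyR] := targetN ty; have ltN := pos_lt yR; have oltN := pos_lt oyR.
  have lei x : x \notin R -> m1 x = 0 -> i <= pos x.
    move=> xR mx; rewrite leqNgt; apply/negP => /m1p; by rewrite posK // mx.
  (* The [n] rounds may exceed a full turn; an unmarked dart shows that the first turn is not
     over. *)
  have posy : pos y = i.
    have := lei y yR my; rewrite leq_eqVlt => /predU1P[//|lti].
    by move: (lti); rewrite Ey at_posK ?ltnn // (ltn_trans lti).
  have ltpos : pos y < pos (opp y).
    rewrite ltn_neqAle posy lei ?m1opp // andbT -posy; apply/eqP => E.
    by have := opp_neq M y; rewrite -(pos_inj yR oyR E) eqxx.
  (* A saturated bridge was marked from the stack. A cut edge not saturated along [y] is saturated
     along [opp y], which would have been met before. *)
  have cE : if saturated O y then y \notin T else y \in T.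
    case: ifP => [saty|/negbT saty].
      apply/negP => yT; have bry : bridge y by rewrite /bridge yT yR oyR.
      by have := m1m y; rewrite my m0E (search_end_saturated bry saty) orbT => /(_ erefl).
    have [//|yT] := boolP (y \in T).
    have [_ _ _ /(_ y yT)/orP[sat|sat] _] := canT; first by rewrite sat in saty.
    have oyT : opp y \notin T by rewrite opp_inT.
    by have := pos_cut oyT sat; rewrite (oppK M) ltnNge ltnW.
  split.
  - by move=> x; rewrite !(eq_opp M) (oppK M) m1opp orbC.
  - move=> x; case: ifP => [xy|_]; last exact: m1T.
    have -> : (x \in T) = (y \in T) by case/orP: xy => /eqP->; rewrite ?opp_inT.
    by case: ifP cE => _ h; [constructor 3|constructor 2].
  - move=> x mx; case: ifP => // /orP[]/eqP E; case: mx; rewrite E ?m1opp //.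
  - by case: ifP.
have all_inv i : inv i (iter i (cut_step M O) (m, o)).
  elim: i => [|i IH]; last by rewrite iterS; apply: step.
  split=> //= x; case: (eqVneq (m x) 1) => [E|].
    by constructor 2; split=> //; apply: m0T.
  by rewrite m0E; case: [|| _, _ | _] => // _; constructor 1.
have [_ mopp mT mm mp] := all_inv n.
(* The rounds cover all [N] positions, and the darts of the root face were marked at the start. *)
move=> x; have nz : (iter n (cut_step M O) (m, o)).1 x != 0.
  have [xR|xR] := boolP (x \in R); last first.
    by rewrite -(posK xR) mp // (leq_trans (pos_lt xR)) // walk_length_le.
  by rewrite mm // m0E /target xR.
by case: (mT x) => [E|[-> ->] //|[-> /negbTE->] //]; rewrite E in nz.
Qed.

End Forest.

(** * Straight-line code and counted loops *)

Fixpoint loop_free (P : program) : bool :=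
  match P with
  | Seq P Q | If _ P Q => loop_free P && loop_free Q
  | While _ _ => false
  | _ => true
  end.

(** A loop, excluded by [loop_free], returns the state unchanged as a default value. *)
Fixpoint run (P : program) (s : state) : state :=
  match P with
  | Const r v => set_reg s r v
  | Copy r r' => set_reg s r (reg s r')
  | Inc r => set_reg s r (reg s r).+1
  | Dec r => set_reg s r (reg s r).-1
  | Read r a i => set_reg s r (arr s a (reg s i))
  | Write a i r => set_arr s a (reg s i) (reg s r)
  | Seq P Q => run Q (run P s)
  | If b P Q => if eval_test s b then run P s else run Q s
  | Skip | While _ _ => s
  end.

Fixpoint cost (P : program) : nat :=
  match P with
  | Seq P Q => cost P + cost Q
  | If _ P Q => (cost P + cost Q).+1
  | _ => 1
  end.

Lemma exec_run P s : loop_free P -> exists2 t, exec P s t (run P s) & t <= cost P.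
Proof.
elim: P s => /=; try by (move=> *; exists 1; first by constructor).
- move=> P IHP Q IHQ s /andP[/(IHP s)[t eP tP] /(IHQ (run P s))[t' eQ tQ]].
  by exists (t + t'); [apply: ExecSeq eP eQ|apply: leq_add].
- move=> b P IHP Q IHQ s /andP[/(IHP s)[t eP tP] /(IHQ s)[t' eQ tQ]].
  case: (boolP (eval_test s b)) => hb.
    by exists t.+1; [apply: ExecIfTrue|rewrite ltnS (leq_trans tP) ?leq_addr].
  by exists t'.+1; [apply: ExecIfFalse|rewrite ltnS (leq_trans tQ) ?leq_addl].
Qed.

Definition block (Ps : seq program) : program := foldr Seq Skip Ps.

(* Register 0 holds the number of rounds, and register 3 is never written: it
   holds [0]. *)
Definition rounds (P : program) : program :=
  Seq (Copy 7 0) (While (TestLt 3 7) (Seq (Dec 7) P)).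

Definition reaches (P : program) (s : state) (b : nat) (Q : state -> Prop) :=
  exists t s', [/\ exec P s t s', Q s' & t <= b].

Lemma reaches_run (P : program) s (Q : state -> Prop) :
  loop_free P -> Q (run P s) -> reaches P s (cost P) Q.
Proof. by move=> /(exec_run s)[t e le] q; exists t, (run P s). Qed.

Lemma reaches_nil s (Q : state -> Prop) : Q s -> reaches (block [::]) s 1 Q.
Proof. by move=> q; exists 1, s; split=> //; apply: ExecSkip. Qed.

Lemma reaches_cons (P : program) Ps s b b' (Q Q' : state -> Prop) :
  reaches P s b Q -> (forall s', Q s' -> reaches (block Ps) s' b' Q') ->
  reaches (block (P :: Ps)) s (b + b') Q'.
Proof.
case=> t [s' [e q le]] /(_ _ q)[t' [s2 [e' q' le']]].
by exists (t + t'), s2; split=> //; [apply: ExecSeq e e'|apply: leq_add].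
Qed.

(** [I i] holds after [i] rounds. Register 7 counts down and also serves as an index sweeping the
    darts from [n - 1] to 0. *)
Lemma reaches_rounds (P : program) (I : nat -> state -> Prop) n s : loop_free P ->
    reg s 0 = n -> I 0 (set_reg s 7 n) ->
    (forall i s', i <= n -> I i s' -> reg s' 3 = 0 /\ reg s' 7 = n - i) ->
    (forall i s', i < n -> I i s' -> I i.+1 (run P (set_reg s' 7 (n - i.+1)))) ->
  reaches (rounds P) s (2 + n * (cost P + 2)) (I n).
Proof.
move=> lP sn I0 regI stepI.
suff loop j s1 : j <= n -> I (n - j) s1 -> exists t s',
    [/\ exec (While (TestLt 3 7) (Seq (Dec 7) P)) s1 t s', I n s'
      & t <= 1 + j * (cost P + 2)].
  have In0 : I (n - n) (set_reg s 7 n) by rewrite subnn.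
  have [t [s' [e In le]]] := loop n _ (leqnn n) In0.
  exists (1 + t), s'; split=> //; first by apply: ExecSeq e; rewrite -sn; apply: ExecCopy.
elim: j s1 => [|j IH] s1 lejn Is1; have [r3 r7] := regI _ _ (leq_subr _ _) Is1.
  exists 1, s1; split; [|by rewrite subn0 in Is1|by []].
  by apply: ExecWhileFalse; rewrite /= r3 r7 subn0 subnn.
have Is2 : I (n - j) (run P (set_reg s1 7 j)).
  have ltn : n - j.+1 < n by lia.
  have := stepI _ _ ltn Is1; have -> : (n - j.+1).+1 = n - j by lia.
  by have -> : n - (n - j) = j by lia.
have [t [s' [e In le]]] := IH _ (ltnW lejn) Is2.
have [t' e' le'] := exec_run (set_reg s1 7 j) lP.
exists (1 + t' + t).+1, s'; split=> //; last by lia.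
apply: ExecWhileTrue e; first by rewrite /= r3 r7; lia.
apply: ExecSeq e'; have -> : j = (reg s1 7).-1 by rewrite r7; lia.
exact: ExecDec.
Qed.

(** Registers: 8 is the current dart, 9 and 11 are auxiliary, 10 is the size of the
    stack. Arrays: 3 holds the marks, 4 the darts visited by the search, 5 the
    inverse of [rot] and 6 the stack. *)

Definition constants k := block [:: Const 4 1; Const 5 k; Const 6 2].

Definition invert_rot := block [:: Read 8 0 7; Write 5 8 7].

Definition mark_root := block [:: Write 3 8 4; Read 8 1 8; Write 3 8 4; Read 8 0 8].

Definition search_round :=
  block [:: Read 9 3 8; If (TestEq 9 3) (block [:: Read 9 4 8;
    If (TestEq 9 3)
      (block [:: Write 4 8 4; Read 9 2 8;
        If (TestLt 3 9) (block [:: Write 6 10 8; Inc 10; Read 8 1 8]) (Read 8 5 8)])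
      (If (TestEq 10 3) Skip (block [:: Dec 10; Read 8 6 10; Read 8 5 8]))]) Skip].

Definition mark_stack :=
  If (TestEq 10 3) Skip
    (block [:: Dec 10; Read 8 6 10; Write 3 8 4; Read 8 1 8; Write 3 8 4]).

Definition cut_round :=
  block [:: Read 9 3 8; If (TestEq 9 3)
    (block [:: Read 9 2 8; Read 11 1 8; If (TestEq 9 5)
      (block [:: Write 3 8 6; Write 3 11 6; Read 8 0 8])
      (block [:: Write 3 8 4; Write 3 11 4; Read 8 0 11])])
    (If (TestEq 9 4) (block [:: Read 8 1 8; Read 8 0 8]) (Read 8 0 8))].

Definition output_round :=
  block [:: Read 9 3 7;
    If (TestEq 9 4) (Write 2 7 3)
      (block [:: Read 9 2 7; If (TestEq 9 5) (Write 2 7 4) (Write 2 7 6)])].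

(** The number of search steps and the size of the stack are bounded by [2 * n], whereas a loop has
    [n] rounds: hence the two doubled bodies. *)
Definition opening_program k :=
  block [:: constants k; rounds invert_rot; Copy 8 1; rounds mark_root;
    Copy 8 2; Read 8 5 8; rounds (Seq search_round search_round);
    rounds (Seq mark_stack mark_stack); Copy 8 2; rounds cut_round;
    rounds output_round].

(** * Simulation of the abstract steps by the program *)

Section Refinement.

Variables (n : nat) (M : plane_map n) (k : nat) (O : 'I_n -> 'I_k -> bool).
Local Notation dart := 'I_n.
Local Notation opp := (Defs.opp M).
Local Notation rot := (Defs.rot M).
Local Notation turn := (rot^-1)%g.
Implicit Types (x y : dart) (s : state).

Lemma saturated_copies x : saturated O x = (copies_along O x == k).
Proof.
have -> : (copies_along O x == k) = ([set i | O x i] == [set: 'I_k]).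
  by rewrite eqEcard subsetT cardsT card_ord eqn_leq -[X in _ <= X]card_ord max_card.
apply/forallP/eqP => [h|/setP h i]; first by apply/setP => i; rewrite !inE h.
by have := h i; rewrite !inE.
Qed.

Lemma oriented_copies x : oriented_along O x = (0 < copies_along O x).
Proof.
apply/existsP/card_gt0P => -[i]; first by exists i; rewrite inE.
by rewrite inE; exists i.
Qed.

Lemma table_ord (f : dart -> nat) x : table f x = f x.
Proof. by rewrite /table valK. Qed.

Definition regs_ok s c :=
  [/\ reg s 0 = n, reg s 1 = root_dart M, reg s 2 = outer_dart M, reg s 3 = 0 &
   [/\ reg s 4 = 1, reg s 5 = k, reg s 6 = 2 & reg s 7 = c]].

Definition map_ok s := forall x, arr s 0 x = rot x /\ arr s 1 x = opp x.

Definition frame s c :=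
  [/\ regs_ok s c, map_ok s & forall x, arr s 2 x = copies_along O x].

Lemma constants_frame : frame (run (constants k) (input M O)) 0.
Proof. by split=> // x; rewrite /= ?table_ord //; split; rewrite table_ord. Qed.

Lemma frame_of s s' c c' : frame s c -> (forall r, r < 7 -> reg s' r = reg s r) ->
  reg s' 7 = c' -> (forall a j, a < 3 -> arr s' a j = arr s a j) -> frame s' c'.
Proof.
case=> -[r0 r1 r2 r3 [r4 r5 r6 r7]] mapM cop hr r7' ha; split.
- by do ![split] => //; rewrite hr.
- by move=> x; rewrite !ha.
- by move=> x; rewrite ha.
Qed.

Ltac keep_frame fr :=
  by apply: (frame_of fr) => [[|[|[|[|[|[|[|?]]]]]]]||[|[|[|?]]] ?] //=; apply fr.

Definition inverted i s := frame s (n - i) /\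
  [/\ forall x, arr s 3 x = 0, forall x, arr s 4 x = 0, reg s 10 = 0 &
    forall x, n - i <= x -> arr s 5 (rot x) = x].

Lemma invert_rot_step i s : i < n -> inverted i s ->
  inverted i.+1 (run invert_rot (set_reg s 7 (n - i.+1))).
Proof.
move=> ltin [fr [m3 m4 r10 inv]].
have [[r0 r1 r2 r3 [r4 r5 r6 r7]] mapM cop] := fr.
have ltc : n - i.+1 < n by lia.
pose c := Ordinal ltc; have [rotc _] := mapM c.
split; first by keep_frame fr.
split=> //= x lex; rewrite /= rotc; case: eqVneq => [/val_inj/perm_inj->|neq] //=.
apply: inv; have : x != c by apply: contraNneq neq => ->.
by rewrite -val_eqE /=; lia.
Qed.

Definition root_marks i x :=
  has (fun z => (x == z) || (x == opp z)) (traject (face_next M) (root_dart M) i).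

Definition root_marked i s := frame s (n - i) /\
  [/\ forall x, arr s 3 x = root_marks i x, forall x, arr s 4 x = 0, reg s 10 = 0,
    forall x, arr s 5 x = turn x & reg s 8 = iter i (face_next M) (root_dart M)].

Lemma mark_root_step i s : i < n -> root_marked i s ->
  root_marked i.+1 (run mark_root (set_reg s 7 (n - i.+1))).
Proof.
move=> _ [fr [m3 m4 r10 inv r8]].
have [[r0 r1 r2 r3 [r4 r5 r6 r7]] mapM cop] := fr.
set y := iter i _ _ in r8; have [roty oppy] := mapM y; have [rotoy _] := mapM (opp y).
split; first by keep_frame fr.
split=> //=; last by rewrite r8 oppy rotoy -/y /face_next permM.
move=> x; rewrite /root_marks trajectSr -cats1 has_cat /= orbF -/y r8 oppy r4 m3.
rewrite !val_eqE; case: eqVneq => _ /=; first by rewrite !orbT.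
by case: eqVneq => _ /=; rewrite ?orbT ?orbF.
Qed.

(** The root face has at most [n] darts; going around it again adds no mark. *)
Lemma root_marks_end x : root_marks n x = on_root_cycle M x.
Proof.
have mem z : (z \in traject (face_next M) (root_dart M) n) = (z \in root_face M).
  rewrite /root_face /face; apply/idP/idP.
    by case/trajectP=> j _ ->; apply/porbit_iterP; exists j.
  rewrite porbit_traject => /trajectP[j ltj ->]; apply/trajectP; exists j => //.
  apply: leq_trans ltj _; by rewrite -[X in _ <= X]card_ord max_card.
apply/hasP/orP => [[z]|[]].
- rewrite mem => zR /orP[]/eqP->; [by left|by right; rewrite (oppK M)].
- by move=> xR; exists x; rewrite ?mem ?eqxx.
- by move=> xR; exists (opp x); rewrite ?mem // (oppK M) eqxx orbT.
Qed.

(** The head of the list is the top of the stack, whose bottom has index 0. *)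
Fixpoint stack_ok (a : nat -> nat) (st : seq dart) :=
  if st is g :: st' then a (size st') = g /\ stack_ok a st' else True.

Lemma stack_ok_ext a a' st : (forall j, j < size st -> a' j = a j) ->
  stack_ok a st -> stack_ok a' st.
Proof.
elim: st => //= g st IH h [E /IH ok]; split; first by rewrite h.
by apply: ok => j lt; apply: h; apply: ltnW.
Qed.

Definition searching c (a : search_state n) s :=
  let: (X, y, st) := a in frame s c /\
  [/\ forall x, arr s 3 x = on_root_cycle M x, forall x, arr s 4 x = (x \in X),
    forall x, arr s 5 x = turn x, reg s 8 = y &
    reg s 10 = size st /\ stack_ok (arr s 6) st].

Lemma search_round_step c a s : searching c a s ->
  searching c (search_step M O a) (run search_round s).
Proof.
case: a => [[X y] st] [fr [m3 m4 inv r8 [r10 ok]]].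
have [[r0 r1 r2 r3 [r4 r5 r6 r7]] mapM cop] := fr.
have [_ oppy] := mapM y.
rewrite /search_round /= r8 r3 m3; case: (boolP (on_root_cycle M y)) => ty /=.
  by split; first by keep_frame fr.
rewrite m4; case: (boolP (y \in X)) => yX /=.
  rewrite r10; case: st => [|g st] in r10 ok * => /=.
    by split; first by keep_frame fr.
  case: ok => okg ok; split; first by keep_frame fr.
  by split=> //=; rewrite okg inv.
have m4' x : (if nat_of_ord x == y then reg s 4 else arr s 4 x) = (x \in y |: X).
  by rewrite val_eqE !inE r4 m4; case: eqVneq.
rewrite cop oriented_copies; case: ifP => oy /=; split; try by keep_frame fr.
  split=> //=.
  rewrite r10; split=> //; rewrite eqxx; split=> //.
  by apply: stack_ok_ext ok => j lt /=; case: eqVneq lt => // ->; rewrite ltnn.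
by split=> //=; rewrite inv.
Qed.

Lemma size_search_step a : size (search_step M O a).2 <= (size a.2).+1.
Proof.
case: a => [[X y] st] /=; case: ifP => // _; case: ifP => _; last by case: ifP.
by case: st => //= g st; rewrite -addn2 leq_addr.
Qed.

(* [st0] is the stack left by the search, [st] the part of it not yet marked. *)
Definition popping c (st0 st : seq dart) s := frame s c /\
  exists st1, [/\ st0 = st1 ++ st,
    forall x, arr s 3 x = [|| on_root_cycle M x, x \in st1 | opp x \in st1],
    reg s 10 = size st & stack_ok (arr s 6) st].

Lemma mark_stack_step c st0 st s : popping c st0 st s ->
  popping c st0 (behead st) (run mark_stack s).
Proof.
case=> fr [st1 [Est m3 r10 ok]]; have [[r0 r1 r2 r3 [r4 r5 r6 r7]] mapM cop] := fr.
rewrite /mark_stack /= r10 r3; case: st => [|g st] in r10 ok Est * => /=.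
  by split=> //; exists st1.
case: ok => okg ok; have [_ oppg] := mapM g; split; first by keep_frame fr.
exists (rcons st1 g); split=> //=; rewrite ?cat_rcons ?r10 //.
rewrite okg oppg r4 => x; rewrite m3 !mem_rcons !inE !val_eqE (eq_opp M x g).
by case: eqVneq => _ /=; [rewrite !orbT|case: eqVneq => _ /=; rewrite ?orbT].
Qed.

Definition cutting c (a : (dart -> nat) * dart) s := frame s c /\
  [/\ forall x, arr s 3 x = a.1 x & reg s 8 = a.2].

Lemma cut_round_step c a s : cutting c a s ->
  cutting c (cut_step M O a) (run cut_round s).
Proof.
case: a => m y [fr [/= m3 r8]]; have [[r0 r1 r2 r3 [r4 r5 r6 r7]] mapM cop] := fr.
have [roty oppy] := mapM y; have [rotoy _] := mapM (opp y).
rewrite /cut_step /mark /= r8 r3 m3; case: (eqVneq (m y) 0) => my /=; last first.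
  rewrite r4; case: (eqVneq (m y) 1) => my1 /=; split; try by keep_frame fr.
    by split=> //=; rewrite oppy rotoy.
  by split=> //=; rewrite roty.
rewrite eqxx /= cop r5 saturated_copies oppy.
have m3' v x : (if nat_of_ord x == opp y then v else if nat_of_ord x == y then v
    else arr s 3 x) = if (x == y) || (x == opp y) then v else m x.
  by rewrite !val_eqE m3; case: (x == opp y); case: (x == y).
case: (eqVneq (copies_along O y) k) => sat /=; split; try by keep_frame fr.
  by split=> //= x; rewrite r6 m3'.
by split=> //= x; rewrite r4 m3'.
Qed.

Definition kind (m : dart -> nat) x :=
  if m x == 1 then 0 else if saturated O x then 1 else 2.

(** Array 2 is overwritten in place from its last entry down, so the entries below [n - i] still
    count copies. *)
Definition output_marked (m : dart -> nat) i s :=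
  [/\ regs_ok s (n - i), map_ok s, forall x, arr s 3 x = m x &
    forall x, arr s 2 x = if n - i <= x then kind m x else copies_along O x].

Lemma output_round_step m i s : i < n -> output_marked m i s ->
  output_marked m i.+1 (run output_round (set_reg s 7 (n - i.+1))).
Proof.
move=> ltin [[r0 r1 r2 r3 [r4 r5 r6 r7]] mapM m3 out].
have ltc : n - i.+1 < n by lia.
pose c := Ordinal ltc; have m3c : arr s 3 (n - i.+1) = m c := m3 c.
have outc : arr s 2 (n - i.+1) = copies_along O c.
  by rewrite (out c) /= leqNgt; case: ltnP => //; lia.
have lec x : (n - i.+1 <= x) = (x == c) || (n - i <= x).
  by rewrite -val_eqE /=; lia.
have kindc : kind m c = if m c == 1 then 0 else if copies_along O c == k then 1 else 2.
  by rewrite /kind saturated_copies.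
rewrite /output_round /= m3c outc r4 r5; case: eqVneq kindc => mc /= kindc.
  split=> //= x; rewrite lec -val_eqE /= r3; case: eqVneq => [E|_] //=.
  by have -> : x = c by apply: val_inj.
case: eqVneq kindc => cc /= kindc; split=> //= x.
  rewrite lec -val_eqE /=; case: eqVneq => [E|_] //=.
  by have -> : x = c by apply: val_inj.
rewrite lec -val_eqE /= r6; case: eqVneq => [E|_] //=.
by have -> : x = c by apply: val_inj.
Qed.

Lemma frame_regs s i : frame s (n - i) -> reg s 3 = 0 /\ reg s 7 = n - i.
Proof. by case=> -[_ _ _ ? [_ _ _ ?]]. Qed.

Lemma searching_counter c c' a s : searching c a s ->
  searching c' a (set_reg s 7 c').
Proof. by case: a => [[X y] st] [fr h]; split; first keep_frame fr. Qed.

Lemma popping_counter c c' st0 st s : popping c st0 st s ->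
  popping c' st0 st (set_reg s 7 c').
Proof. by case=> fr h; split; first keep_frame fr. Qed.

Lemma cutting_counter c c' a s : cutting c a s -> cutting c' a (set_reg s 7 c').
Proof. by case=> fr h; split; first keep_frame fr. Qed.

Lemma size_search_end : size (search_end M O).2 <= 2 * n.
Proof.
rewrite /search_end; elim: (2 * n) => // i IH.
by rewrite iterS; apply: leq_trans (size_search_step _) _.
Qed.

Lemma iter_behead (T : Type) (st : seq T) i : size st <= i -> iter i behead st = [::].
Proof.
elim: i st => [|i IH] [|g st] //= le; first by elim: i {IH le} => //= i ->.
by rewrite -iterS iterSr; apply: IH.
Qed.

Definition start_mark x : nat :=
  [|| on_root_cycle M x, x \in (search_end M O).2 | opp x \in (search_end M O).2].

Lemma opening_program_reaches :
  reaches (opening_program k) (input M O) (48 + n * 300)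
    (output_marked (iter n (cut_step M O) (start_mark, outer_dart M)).1 n).
Proof.
pose marks0 s := [/\ forall x, arr s 3 x = 0, forall x, arr s 4 x = 0 & reg s 10 = 0].
pose bound P := 2 + n * (cost P + 2).
suff : reaches (opening_program k) (input M O) (4 + (bound invert_rot + (1 +
    (bound mark_root + (1 + (1 + (bound (Seq search_round search_round) +
    (bound (Seq mark_stack mark_stack) + (1 + (bound cut_round +
    (bound output_round + 1)))))))))))
    (output_marked (iter n (cut_step M O) (start_mark, outer_dart M)).1 n).
  case=> t [s [e q le]]; exists t, s; split=> //; apply: leq_trans le _.
  by rewrite /bound /=; lia.
apply: (reaches_cons (Q := fun s => frame s (n - n) /\ marks0 s)).
  by apply: reaches_run => //; rewrite subnn; split; first exact: constants_frame.
move=> s [fr [m3 m4 r10]]; apply: (reaches_cons (Q := inverted n)).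
  apply: reaches_rounds => //; first by case: fr => -[].
  - split; first by rewrite subn0; keep_frame fr.
    by split=> // x; rewrite subn0 leqNgt ltn_ord.
  - by move=> i s' _ [/frame_regs].
  - exact: invert_rot_step.
move=> {fr m3 m4 r10} s [fr [m3 m4 r10 inv]].
apply: (reaches_cons (Q := fun s' => frame s' (n - n) /\ root_marked 0 (set_reg s' 7 n))).
  apply: reaches_run => //; split; first keep_frame fr.
  split; first by rewrite subn0; keep_frame fr.
  split=> //= [x|]; last by case: fr => -[].
  by rewrite -{1}(permKV rot x) inv // subnn.
move=> {fr m3 m4 r10 inv} s [fr root0]; apply: (reaches_cons (Q := root_marked n)).
  apply: reaches_rounds => //; first by case: fr => -[].
  - by move=> i s' _ [/frame_regs].
  - exact: mark_root_step.
move=> {fr root0} s [fr [m3 m4 r10 inv _]].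
apply: (reaches_cons (Q := fun s' => frame s' (n - n) /\
   [/\ forall x, arr s' 3 x = root_marks n x, forall x, arr s' 4 x = 0, reg s' 10 = 0,
    forall x, arr s' 5 x = turn x & reg s' 8 = outer_dart M])).
  apply: reaches_run => //; split; first keep_frame fr.
  by split=> //=; case: fr => -[].
move=> {fr m3 m4 r10 inv} s [fr [m3 m4 r10 inv r8]].
apply: (reaches_cons (Q := searching (n - n) (search_start M))).
  apply: reaches_run => //; split; first keep_frame fr.
  by split=> //= [x|x|]; rewrite ?m3 ?root_marks_end ?inE ?r8.
move=> {fr m3 m4 r10 inv r8} s sch.
apply: (reaches_cons (Q := searching (n - n) (search_end M O))).
  apply: (reaches_rounds
    (I := fun i => searching (n - i) (iter (2 * i) (search_step M O) (search_start M)))) => //.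
  - by case: sch => -[[]].
  - by rewrite muln0 subn0; apply: searching_counter sch.
  - by move=> i s' _; case: (iter _ _ _) => [[X y] st] [/frame_regs].
  - move=> i s' _ h; rewrite mulnS /=; do 2!apply: search_round_step.
    exact: searching_counter h.
move=> {sch} s; case E : (search_end M O) => [[X y] st] [fr [m3 _ _ _ [r10 ok]]].
have Est : st = (search_end M O).2 by rewrite E.
apply: (reaches_cons (Q := popping (n - n) st [::])).
  have <- : iter (2 * n) behead st = [::] by rewrite iter_behead // Est size_search_end.
  apply: (reaches_rounds (I := fun i => popping (n - i) st (iter (2 * i) behead st))) => //.
  - by case: fr => -[].
  - rewrite muln0 subn0; split; first keep_frame fr.
    by exists [::]; split=> // x; rewrite m3 orbF.
  - by move=> i s' _ [/frame_regs].
  - move=> i s' _ h; rewrite mulnS /=; do 2!apply: mark_stack_step.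
    exact: popping_counter h.
move=> {fr m3 r10 ok} s [fr [st1 [Est1 m3 r10 _]]]; rewrite cats0 in Est1; subst st1.
apply: (reaches_cons (Q := cutting (n - n) (start_mark, outer_dart M))).
  apply: reaches_run => //; split; first keep_frame fr.
  split=> [x|] /=; last by case: fr => -[].
  by rewrite m3 /start_mark -Est.
move=> {fr m3 r10} s cut.
apply: (reaches_cons
  (Q := cutting (n - n) (iter n (cut_step M O) (start_mark, outer_dart M)))).
  apply: (reaches_rounds
    (I := fun i => cutting (n - i) (iter i (cut_step M O) (start_mark, outer_dart M)))) => //.
  - by case: cut => -[[]].
  - by rewrite subn0; apply: cutting_counter cut.
  - by move=> i s' _ [/frame_regs].
  - by move=> i s' _ h; apply: cut_round_step; apply: cutting_counter h.
move=> {cut} s [fr [m3 _]]; set m := (iter n _ _).1 in m3 *.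
apply: (reaches_cons (Q := output_marked m n)); last by move=> s'; apply: reaches_nil.
have [[r0 r1 r2 r3 [r4 r5 r6 _]] mapM cop] := fr.
apply: reaches_rounds => //.
- split=> // [|x]; first by rewrite subn0.
  by rewrite subn0 leqNgt ltn_ord /= cop.
- by move=> i s' _ [[_ _ _ ? [_ _ _ ?]]].
- exact: output_round_step.
Qed.

End Refinement.

Theorem theorem6p5 (d : nat) (hd : 3 <= d) :
  exists (P : program) (c : nat),
    forall (n : nat) (M : plane_map n) (O : 'I_n -> 'I_(d - 2) -> bool),
      d_angulation M d -> d_orientation M O -> minimal M O ->
      exists (t : nat) (s : state),
        [/\ exec P (input M O) t s,
            t <= c * nedges M
          & forall B : blossoming_forest n,
              is_blossoming_forest_of M O B -> output_represents s B].
Proof.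
(* As [n] is twice the number of edges, which is positive, 48 + 300 [n] is at most 648 times that
   number. *)
exists (opening_program (d - 2)), 648 => n M O dangM [fracO _] _.
have [t [s [exec_s [[r0 r1 _ _ _] mapM _ out] le_t]]] := opening_program_reaches M O.
(* The run is fixed before [T] is given, so its marks agree with every canonical forest. *)
exists t, s; split=> // [|B [T canT ->]].
  have := ltn_ord (root_dart M); have := ndarts M; lia.
have kindE (x : 'I_n) : arr s 2 x = kind O (fun y => if y \in T then 1 else 2) x.
  by rewrite out subnn /kind (cut_walk hd dangM fracO canT).
split=> // x /=; first by case: (mapM x).
rewrite kindE /kind; case: ifP => xT /=; first by case: (mapM x).
by case: ifP.
Qed.
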